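(* (i) For every $\mathbf t\in\mathbb R^d$ and $M\ge0$, \begin{align*} &\mathrm P_{\Sigma^{-1/2}\boldsymbol\Delta=\mathbf t}\big((\hat{\boldsymbol\tau}_{\rm PT}-\boldsymbol\tau)^\top(\Sigma_0^{-1}+\Sigma_1^{-1})(\hat{\boldsymbol\tau}_{\rm PT}-\boldsymbol\tau)\le M\big)\\ ={}&\Psi_d\big(M;\|(\Sigma_0^{-1}+\Sigma_1^{-1})^{-1/2}\Sigma_1^{-1}\Sigma^{1/2}\mathbf t\|_2^2\big)\,\Psi_d\big(q;\|(\Sigma_0+\Sigma_1)^{-1/2}\Sigma^{1/2}\mathbf t\|_2^2\big)\\ &+\int_{\|\mathbf u\|_2^2>q}\Psi_d\big(M;\|(\Sigma_0^{-1}+\Sigma_1^{-1})^{-1/2}\Sigma_1^{-1}[\Sigma^{1/2}\mathbf t-(\Sigma_0+\Sigma_1)^{1/2}\mathbf u]\|_2^2\big)\,\phi_{(\Sigma_0+\Sigma_1)^{-1/2}\Sigma^{1/2}\mathbf t,\,I_d}(\mathbf u)\,d\mathbf u. \end{align*} (ii) Let \[ \hat M_{\rm PT}=\inf\Big\{M\ge0:\inf_{\boldsymbol\Delta:|\Sigma^{-1/2}\boldsymbol\Delta|\le\mathbf b}\mathrm P_{\boldsymbol\Delta}\big((\hat{\boldsymbol\tau}_{\rm PT}-\boldsymbol\tau)^\top(\Sigma_0^{-1}+\Sigma_1^{-1})(\hat{\boldsymbol\tau}_{\rm PT}-\boldsymbol\tau)\le M\big)\ge1-\zeta\Big\}. \]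 Then $\hat M_{\rm PT}$ is the solution in $M$ of \[ \inf_{\boldsymbol\Delta:|\Sigma^{-1/2}\boldsymbol\Delta|\le\mathbf b}\mathrm P_{\boldsymbol\Delta}\big((\hat{\boldsymbol\tau}_{\rm PT}-\boldsymbol\tau)^\top(\Sigma_0^{-1}+\Sigma_1^{-1})(\hat{\boldsymbol\tau}_{\rm PT}-\boldsymbol\tau)\le M\big)=1-\zeta. \]
   Context: Let $d\ge1$, $\boldsymbol\tau\in\mathbb R^d$ unknown and $\boldsymbol\Delta\in\mathbb R^d$ an unknown bias. We observe independent random vectors $\hat{\boldsymbol\tau}_0\sim N_d(\boldsymbol\tau,\Sigma_0)$ and $\hat{\boldsymbol\tau}_1\sim N_d(\boldsymbol\tau+\boldsymbol\Delta,\Sigma_1)$, where $\Sigma_0,\Sigma_1$ are known symmetric positive definite matrices. Let $\Sigma$ be a fixed symmetric positive definite scaling matrix. Matrix square roots are symmetric square roots. Let $\mathbf b\in[0,\infty)^d$. The constraint $|\Sigma^{-1/2}\boldsymbol\Delta|\le\mathbf b$ means $|[\Sigma^{-1/2}\boldsymbol\Delta]_j|\le b_j$ for all $j$. $\Psi_d(\cdot;\lambda)$ is the CDF of the noncentral chi-squared distribution with $d$ degrees of freedom and noncentrality $\lambda$, i.e. the law of $\|\mathbf Z\|_2^2$ with $\mathbf Z\sim N(\boldsymbol\mu,I_d)$ and $\|\boldsymbol\mu\|_2^2=\lambda$. $\phi_{\boldsymbol\mu,I_d}$ is the density of $N(\boldsymbol\mu,I_d)$. Fix $\zeta\in(0,1)$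 and a threshold $q\ge0$. The pretest estimator is \[ \hat{\boldsymbol\tau}_{\rm PT}=\hat{\boldsymbol\tau}_0+(\Sigma_0^{-1}+\Sigma_1^{-1})^{-1}\Sigma_1^{-1}(\hat{\boldsymbol\tau}_1-\hat{\boldsymbol\tau}_0)\,\mathbf 1\big(\|(\Sigma_0+\Sigma_1)^{-1/2}(\hat{\boldsymbol\tau}_1-\hat{\boldsymbol\tau}_0)\|_2^2\le q\big). \] $\mathrm P_{\boldsymbol\Delta}$ denotes probability under bias $\boldsymbol\Delta$, and $\mathrm P_{\Sigma^{-1/2}\boldsymbol\Delta=\mathbf t}$ means probability under $\boldsymbol\Delta=\Sigma^{1/2}\mathbf t$. These probabilities do not depend on $\boldsymbol\tau$. *)

(* Defs.v *)
From HB Require Import structures.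
From mathcomp Require Import all_boot all_order all_algebra.
From mathcomp Require Import all_classical all_reals all_analysis.
Set Implicit Arguments. Unset Strict Implicit. Unset Printing Implicit Defensive.
Import Order.TTheory GRing.Theory Num.Theory.
Local Open Scope ring_scope.
Local Open Scope classical_set_scope.

Definition sqnorm {R : realType} {n : nat} (v : 'cV[R]_n) : R :=
  \sum_(i < n) (v i ord0) ^+ 2.

Definition quadform {R : realType} {n : nat} (A : 'M[R]_n) (v : 'cV[R]_n) : R :=
  (v^T *m A *m v) ord0 ord0.

Definition posdef {R : realType} {n : nat} (A : 'M[R]_n) : Prop :=
  A^T = A /\ forall v : 'cV[R]_n, v != 0 -> 0 < quadform A v.

Definition is_sqrtm {R : realType} {n : nat} (A S : 'M[R]_n) : Prop :=
  S^T = S /\ (forall v : 'cV[R]_n, 0 <= quadform S v) /\ S *m S = A.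

Definition sqrtm {R : realType} {n : nat} (A : 'M[R]_n) : 'M[R]_n :=
  xget 0 [set S | is_sqrtm A S].

Definition invsqrtm {R : realType} {n : nat} (A : 'M[R]_n) : 'M[R]_n :=
  invmx (sqrtm A).

(* Lebesgue integral over R^n (of a nonnegative function), written as the
   iterated one-dimensional Lebesgue integral (Tonelli). *)
Fixpoint iter_lebint {R : realType} (n : nat) (F : seq R -> \bar R) : \bar R :=
  match n with
  | 0 => F [::]
  | n'.+1 => (\int[@lebesgue_measure R]_x iter_lebint n' (fun s => F (x :: s)))%E
  end.

Definition lebint {R : realType} (n : nat) (F : 'cV[R]_n -> \bar R) : \bar R :=
  iter_lebint n (fun s => F (\col_(i < n) nth 0 s i)).

Definition gauss_pdf {R : realType} {n : nat} (mu : 'cV[R]_n) (S : 'M[R]_n)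
    (x : 'cV[R]_n) : R :=
  (Num.sqrt ((pi *+ 2) ^+ n * \det S))^-1 *
  expR (- (quadform (invmx S) (x - mu)) / 2).

(* Psi_n(x; lam): CDF at x of ||Z||^2, Z ~ N(mu, I_n) with ||mu||^2 = lam
   (mu chosen as sqrt(lam) e_1; the law depends on mu only through ||mu||). *)
Definition ncchi2_cdf {R : realType} (n : nat) (x lam : R) : R :=
  fine (@lebint R n (fun z : 'cV[R]_n =>
    if sqnorm z <= x then
      (gauss_pdf (\col_(i < n) (if (i : nat) == 0%N then Num.sqrt lam else 0))
                 1%:M z)%:E
    else 0%E)).

(* the pretest estimator as a function of the observations x0 = tau0hat,
   x1 = tau1hat *)
Definition tau_PT {R : realType} {n : nat} (S0 S1 : 'M[R]_n) (q : R)
    (x0 x1 : 'cV[R]_n) : 'cV[R]_n :=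
  x0 + (if sqnorm (invsqrtm (S0 + S1) *m (x1 - x0)) <= q
        then invmx (invmx S0 + invmx S1) *m invmx S1 *m (x1 - x0)
        else 0).

(* P_Delta((tauPT - tau)^T (S0^-1 + S1^-1) (tauPT - tau) <= M), with
   tau0hat ~ N(tau, S0), tau1hat ~ N(tau + Delta, S1) independent *)
Definition prob_PT {R : realType} {n : nat} (S0 S1 : 'M[R]_n) (q : R)
    (tau Delta : 'cV[R]_n) (M : R) : R :=
  fine (@lebint R n (fun x0 => @lebint R n (fun x1 =>
    if quadform (invmx S0 + invmx S1) (tau_PT S0 S1 q x0 x1 - tau) <= M
    then (gauss_pdf tau S0 x0 * gauss_pdf (tau + Delta) S1 x1)%:E
    else 0%E))).

Definition bias_ok {R : realType} {n : nat} (S : 'M[R]_n) (b : 'cV[R]_n)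
    (Delta : 'cV[R]_n) : Prop :=
  forall j : 'I_n, `|(invsqrtm S *m Delta) j ord0| <= b j ord0.

Definition inf_prob_PT {R : realType} {n : nat} (S0 S1 S : 'M[R]_n) (b : 'cV[R]_n)
    (q : R) (tau : 'cV[R]_n) (M : R) : R :=
  inf [set prob_PT S0 S1 q tau Delta M | Delta in [set D | bias_ok S b D]].

Definition M_PT {R : realType} {n : nat} (S0 S1 S : 'M[R]_n) (b : 'cV[R]_n)
    (q zeta : R) (tau : 'cV[R]_n) : R :=
  inf [set M : R | 0 <= M /\ 1 - zeta <= inf_prob_PT S0 S1 S b q tau M].

(* Main.v *)
(* Put T = S0 + S1, H = S0^-1 + S1^-1 and u = T^(-1/2) (tau1hat - tau0hat),
   v = H^(1/2) (tau0hat - tau + H^-1 S1^-1 (tau1hat - tau0hat)). In these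
   coordinates the joint density is a product of two standard Gaussian densities
   centred at T^(-1/2) Delta and H^(-1/2) S1^-1 Delta: the quadratic forms match by
   completing the square and the constants match because H = S0^-1 T S1^-1. The
   loss is |v|^2 if |u|^2 <= q and |v - H^(-1/2) S1^-1 T^(1/2) u|^2 otherwise, so
   integrating v first gives (i); the law of |v|^2 depends only on the norm of the
   mean by invariance under a Householder reflection.
   For (ii), let G be the infimum of the coverage probability. Uniformly in the
   mean, a Gaussian gives a shell M1 < |v|^2 <= M2 mass at most 2 sqrt(M2 - M1), and
   for means in a bounded set the mass is bounded away from 0, while large balls
   have mass close to 1. Integrating these bounds over u, and over bounded u for
   the last two, shows that G is continuous, strictly increasing on [0, oo[ and
   tends to 1, whereas G vanishes on ]-oo, 0[. Hence G takes the value 1 - zeta at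
   exactly one point, which is the infimum defining M_PT. *)
Require Import Defs.
From HB Require Import structures.
From mathcomp Require Import all_boot all_order all_algebra.
From mathcomp Require Import all_classical all_reals all_analysis.
From mathcomp Require Import measurable_realfun complex spectral ring lra.
Set Implicit Arguments. Unset Strict Implicit. Unset Printing Implicit Defensive.
Import Order.TTheory GRing.Theory Num.Theory.
Import numFieldNormedType.Exports.
Local Open Scope ring_scope.
Local Open Scope classical_set_scope.

(** * Iterated Lebesgue integrals on columns *)

Section col_measurable.
Context {R : realType} (n : nat).

Let coors : 'I_n -> 'cV[R]_n -> measurableTypeR R := fun i v => v i ord0.

Let col_set0 : g_sigma_preimage coors set0.
Proof. exact: sigma_algebra0. Qed.

Let col_setC A : g_sigma_preimage coors A -> g_sigma_preimage coors (~` A).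
Proof. by move=> mA; rewrite -setTD; exact: sigma_algebraCD. Qed.

Let col_bigcup (F : _^nat) : (forall i, g_sigma_preimage coors (F i)) ->
  g_sigma_preimage coors (\bigcup_i (F i)).
Proof. exact: sigma_algebra_bigcup. Qed.

(** Columns carry the sigma-algebra generated by their coordinates, so that measurability of a
    column-valued map can be checked entry by entry. *)
HB.instance Definition _ := @isMeasurable.Build
  default_measure_display
  ('cV[R]_n) (g_sigma_preimage coors) col_set0 col_setC col_bigcup.

Lemma measurable_coor (i : 'I_n) :
  measurable_fun [set: 'cV[R]_n] (fun v : 'cV[R]_n => v i ord0).
Proof.
move=> _ Y mY; rewrite setTI; change (g_sigma_preimage coors (coors i @^-1` Y)).
apply: sub_sigma_algebra => /=; rewrite -bigcup_seq/=; exists i => /=; first by rewrite mem_index_enum.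
by exists Y => //; rewrite setTI.
Qed.

End col_measurable.

Lemma measurable_colP d (T : measurableType d) (R : realType) (n : nat)
    (f : T -> 'cV[R]_n) :
  (forall i, measurable_fun [set: T] (fun t => f t i ord0)) ->
  measurable_fun [set: T] f.
Proof.
move=> mf _ A mA; rewrite setTI.
have mA' : g_sigma_preimage
   (fun i (v : 'cV[R]_n) => v i ord0 : measurableTypeR R) A by exact: mA.
have : preimage_set_system [set: T] f (g_sigma_preimage
   (fun i (v : 'cV[R]_n) => v i ord0 : measurableTypeR R)) (f @^-1` A).
  by exists A => //; rewrite setTI.
rewrite -g_sigma_preimage_comp; apply: smallest_sub.
  exact: sigma_algebra_measurable.
(* With no coordinates the generating family is empty; otherwise each generator is the preimage of a
   Borel set under one coordinate. *)
case: n => [|n] in f mf A mA mA' *; first by rewrite big_ord0.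
rewrite -bigcup_mkord_ord; apply: bigcup_sub => i Ii.
by move=> B [C mC <-]; exact: mf.
Qed.

Lemma measurable_comp2 d1 d2 d3 d (T1 : measurableType d1)
    (T2 : measurableType d2) (U : measurableType d3) (T : measurableType d)
    (F : T1 -> T2 -> U) (f : T -> T1) (g : T -> T2) :
  measurable_fun [set: T1 * T2] (fun p => F p.1 p.2) ->
  measurable_fun [set: T] f -> measurable_fun [set: T] g ->
  measurable_fun [set: T] (fun t => F (f t) (g t)).
Proof.
move=> mF mf mg.
exact: (measurableT_comp mF (measurable_fun_pair mf mg)).
Qed.

(** * Measurability of the vector operations *)

Section measurable_col_ops.
Context d (T : measurableType d) (R : realType).

Lemma measurable_coord n (f : T -> 'cV[R]_n) i :
  measurable_fun [set: T] f -> measurable_fun [set: T] (fun t => f t i ord0).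
Proof. by move=> mf; exact: (measurableT_comp (measurable_coor i)). Qed.

Lemma measurable_col_mx n (f : T -> R) (g : T -> 'cV[R]_n) :
  measurable_fun [set: T] f -> measurable_fun [set: T] g ->
  measurable_fun [set: T] (fun t => col_mx (f t)%:M (g t) : 'cV[R]_n.+1).
Proof.
move=> mf mg; apply: measurable_colP => i.
rewrite [X in measurable_fun _ X](_ : _ = fun t =>
    match fintype.split (i : 'I_(1 + n)) with inl _ => f t | inr j => g t j ord0 end).
  by case: (fintype.split _) => [_|j]//; exact: measurable_coord.
apply/funext => t; rewrite mxE; case: splitP => j _ //.
by rewrite ord1 mxE eqxx.
Qed.

Lemma measurable_mulmx n m (A : 'M[R]_(m, n)) (f : T -> 'cV[R]_n) :
  measurable_fun [set: T] f -> measurable_fun [set: T] (fun t => A *m f t).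
Proof.
move=> mf; apply: measurable_colP => i.
under eq_fun do rewrite mxE.
by apply: measurable_sum => j; apply: measurable_funM => //; exact: measurable_coord.
Qed.

Lemma measurable_addmx n (f g : T -> 'cV[R]_n) :
  measurable_fun [set: T] f -> measurable_fun [set: T] g ->
  measurable_fun [set: T] (fun t => f t + g t).
Proof.
move=> mf mg; apply: measurable_colP => i.
under eq_fun do rewrite mxE.
by apply: measurable_funD; exact: measurable_coord.
Qed.

End measurable_col_ops.

(** * Monotonicity, linearity and Tonelli for iterated integrals *)

Section lebint_theory.
Context {R : realType}.
Local Notation mu := (@lebesgue_measure R).

Lemma lebint0 (F : 'cV[R]_0 -> \bar R) : lebint F = F 0.
Proof. by rewrite /lebint/=; congr F; apply/matrixP => -[]. Qed.

(** The recursion in block form, with the first coordinate split off the column; the inductions on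
    the dimension go through it. *)
Lemma lebintS n (F : 'cV[R]_n.+1 -> \bar R) :
  lebint F = (\int[mu]_x lebint (fun v : 'cV[R]_n => F (col_mx x%:M v)))%E.
Proof.
rewrite /lebint/=; apply: eq_integral => x _; congr iter_lebint.
apply/funext => s; congr F; apply/matrixP => i j; rewrite !mxE.
by case: splitP => k /= ->; rewrite !(mxE, ord1)//= eqxx.
Qed.

Lemma eq_lebint n (F G : 'cV[R]_n -> \bar R) : F =1 G -> lebint F = lebint G.
Proof. by move=> /funext ->. Qed.

Lemma lebint_ge0 n (F : 'cV[R]_n -> \bar R) :
  (forall v, 0 <= F v)%E -> (0 <= lebint F)%E.
Proof.
elim: n F => [|n IH] F F0; first by rewrite lebint0.
by rewrite lebintS; apply: integral_ge0 => x _; exact: IH.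
Qed.

(** The parameter space varies in the induction: the outermost integration variable joins the
    parameter in [T * R], and Tonelli integrates it out again. *)
Lemma measurable_lebint d (T : measurableType d) n (F : T -> 'cV[R]_n -> \bar R) :
  measurable_fun [set: T * 'cV[R]_n] (fun p => F p.1 p.2) ->
  (forall t v, 0 <= F t v)%E ->
  measurable_fun [set: T] (fun t => lebint (F t)).
Proof.
elim: n d T F => [|n IH] d T F mF F0.
  under eq_fun do rewrite lebint0.
  by apply: (measurable_comp2 mF) => //; exact: measurable_cst.
under eq_fun do rewrite lebintS.
refine (@measurable_fun_fubini_tonelli_F _ _ T (measurableTypeR R) R mu
  (fun p => lebint (fun v : 'cV[R]_n => F p.1 (col_mx p.2%:M v))) _ _).
  apply: (IH _ (T * R)%type (fun p v => F p.1 (col_mx p.2%:M v))) => //.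
  apply: (measurable_comp2 mF); first exact: (measurableT_comp measurable_fst).
  apply: measurable_col_mx => //.
  exact: (measurableT_comp measurable_snd).
by move=> p; exact: lebint_ge0.
Qed.

Let measurable_lebint_col n (F : 'cV[R]_n.+1 -> \bar R) :
  measurable_fun setT F -> (forall v, 0 <= F v)%E ->
  measurable_fun [set: R] (fun x : R => lebint (fun v : 'cV[R]_n => F (col_mx x%:M v))).
Proof.
move=> mF F0; apply: (@measurable_lebint _ R n (fun x v => F (col_mx x%:M v))) => //.
apply: (measurableT_comp mF); exact: measurable_col_mx.
Qed.

Let measurable_col n (F : 'cV[R]_n.+1 -> \bar R) x :
  measurable_fun setT F -> measurable_fun setT (fun v : 'cV[R]_n => F (col_mx x%:M v)).
Proof. by move=> mF; apply: (measurableT_comp mF); exact: measurable_col_mx. Qed.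

Lemma le_lebint n (F G : 'cV[R]_n -> \bar R) :
  measurable_fun setT F -> measurable_fun setT G ->
  (forall v, 0 <= F v)%E -> (forall v, F v <= G v)%E -> (lebint F <= lebint G)%E.
Proof.
elim: n F G => [|n IH] F G mF mG F0 FG; first by rewrite !lebint0.
have G0 v : (0 <= G v)%E by exact: le_trans (FG v).
rewrite !lebintS; apply: ge0_le_integral => //.
- by move=> x _; exact: lebint_ge0.
- exact: measurable_lebint_col.
- exact: measurable_lebint_col.
- by move=> x _; apply: IH => //; exact: measurable_col.
Qed.

Lemma lebintD n (F G : 'cV[R]_n -> \bar R) :
  measurable_fun setT F -> measurable_fun setT G ->
  (forall v, 0 <= F v)%E -> (forall v, 0 <= G v)%E ->
  lebint (fun v => F v + G v)%E = (lebint F + lebint G)%E.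
Proof.
elim: n F G => [|n IH] F G mF mG F0 G0; first by rewrite !lebint0.
rewrite !lebintS -ge0_integralD//; first last.
- exact: measurable_lebint_col.
- by move=> x _; exact: lebint_ge0.
- exact: measurable_lebint_col.
- by move=> x _; exact: lebint_ge0.
by apply: eq_integral => x _; apply: IH => //; exact: measurable_col.
Qed.

Lemma lebintZl n (F : 'cV[R]_n -> \bar R) (k : \bar R) :
  measurable_fun setT F -> (forall v, 0 <= F v)%E -> (0 <= k)%E ->
  lebint (fun v => k * F v)%E = (k * lebint F)%E.
Proof.
move=> + + k0; elim: n F => [|n IH] F mF F0; first by rewrite !lebint0.
rewrite !lebintS -ge0_integralZl//; first last.
- by move=> x _; exact: lebint_ge0.
- exact: measurable_lebint_col.
by apply: eq_integral => x _; apply: IH => //; exact: measurable_col.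
Qed.

(** Tonelli in two real variables exchanges [x] with the first coordinate of [v]; the induction
    hypothesis takes care of the other coordinates. *)
Lemma lebint_integral_swap n (F : R -> 'cV[R]_n -> \bar R) :
  measurable_fun [set: R * 'cV[R]_n] (fun p => F p.1 p.2) ->
  (forall x v, 0 <= F x v)%E ->
  (\int[mu]_x lebint (F x) = lebint (fun v => \int[mu]_x F x v))%E.
Proof.
elim: n F => [|n IH] F mF F0.
  by rewrite lebint0; apply: eq_integral => x _; rewrite lebint0.
rewrite lebintS; under eq_integral do rewrite lebintS.
rewrite (@fubini_tonelli _ _ (measurableTypeR R) (measurableTypeR R) R mu mu
  (fun p => lebint (fun v : 'cV[R]_n => F p.1 (col_mx p.2%:M v)))); last 2 first.
- apply: (@measurable_lebint _ (R * R)%type n (fun p v => F p.1 (col_mx p.2%:M v))) => //.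
  apply: (measurable_comp2 mF); first exact: (measurableT_comp measurable_fst).
  by apply: measurable_col_mx => //; exact: (measurableT_comp measurable_snd).
- by move=> p; exact: lebint_ge0.
apply: eq_integral => y _; apply: (IH (fun x v => F x (col_mx y%:M v))) => //.
by apply: (measurable_comp2 mF) => //; exact: measurable_col_mx.
Qed.

Lemma lebint_swap m n (F : 'cV[R]_m -> 'cV[R]_n -> \bar R) :
  measurable_fun [set: 'cV[R]_m * 'cV[R]_n] (fun p => F p.1 p.2) ->
  (forall u v, 0 <= F u v)%E ->
  lebint (fun u => lebint (F u)) = lebint (fun v => lebint (fun u => F u v)).
Proof.
elim: m F => [|m IH] F mF F0.
  by rewrite lebint0; apply: eq_lebint => v; rewrite lebint0.
rewrite lebintS.
under [RHS]eq_lebint do rewrite lebintS.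
rewrite -(@lebint_integral_swap n
  (fun x v => lebint (fun u : 'cV[R]_m => F (col_mx x%:M u) v))); last 2 first.
- apply: (@measurable_lebint _ (R * 'cV[R]_n)%type m
    (fun p u => F (col_mx p.1%:M u) p.2)) => //.
  apply: (measurable_comp2 mF); last exact: (measurableT_comp measurable_snd).
  by apply: measurable_col_mx => //; exact: (measurableT_comp measurable_fst).
- by move=> x v; exact: lebint_ge0.
apply: eq_integral => x _; apply: (IH (fun u v => F (col_mx x%:M u) v)) => //.
by apply: (measurable_comp2 mF) => //; exact: measurable_col_mx.
Qed.

End lebint_theory.

(** * Linear change of variables *)

Section lebint_change.
Context {R : realType}.
Local Notation mu := (@lebesgue_measure R).

Let affine (a c x : R) : measurableTypeR R := a * x + c.

Let measurable_affine a c : measurable_fun [set: measurableTypeR R] (affine a c).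
Proof. by apply: measurable_funD => //; exact: mulrl_measurable. Qed.

Let nu (a c : R) : {measure set (measurableTypeR R) -> \bar R} :=
  measure_function_pushforward__canonical__measure_function_Measure mu
    (measurable_affine a c).

Let pushforward_affine (a c : R) : a != 0 ->
  forall A, measurable A ->
  mu A = mscale (`|a|%:nng)%R (nu a c) A.
Proof.
move=> a0 A mA.
apply: (lebesgue_measure_unique
  (mu := mscale (`|a|%:nng)%R (nu a c))) => //.
move=> _ [[u v] _ <-] /=; rewrite /mscale/= /nu/= /pushforward lebesgue_measure_itv/=.
have a00 : `|a| != 0 by rewrite normr_eq0.
have len : `|a| * ((v - u) / `|a|) = v - u by rewrite mulrC divfK.
(* Half-open intervals determine the measure. A negative [a] reverses the order, so the preimage of
   []u, v]] is then half-open on the other side, with the same length. *)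
move: a0; rewrite neq_lt => /orP[a0|a0].
  rewrite (_ : _ @^-1` _ = `[(v - c) / a, (u - c) / a[%classic); last first.
    apply/seteqP; split => x /=; rewrite !in_itv/= /affine ler_ndivrMr// ltr_ndivlMr//;
     rewrite (mulrC x) => /andP[? ?]; apply/andP; split; lra.
  rewrite lebesgue_measure_itv/= !lte_fin ltr_ndivrMr// divfK ?lt_eqF// ltrD2r.
  case: ifPn => uv; last by rewrite mule0.
  rewrite -!EFinB -EFinM -mulrBl; congr EFin.
  by rewrite ltr0_norm//; field; rewrite lt_eqF.
rewrite (_ : _ @^-1` _ = `](u - c) / a, (v - c) / a]%classic); last first.
  apply/seteqP; split => x /=; rewrite !in_itv/= /affine ler_pdivlMr// ltr_pdivrMr//;
   rewrite (mulrC x) => /andP[? ?]; apply/andP; split; lra.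
rewrite lebesgue_measure_itv/= !lte_fin ltr_pdivrMr// divfK ?gt_eqF// ltrD2r.
case: ifPn => uv; last by rewrite mule0.
rewrite -!EFinB -EFinM -mulrBl; congr EFin.
by rewrite gtr0_norm//; field; rewrite gt_eqF.
Qed.

Lemma integral_affine (a c : R) (f : R -> \bar R) : a != 0 ->
  measurable_fun setT f -> (forall x, 0 <= f x)%E ->
  (\int[mu]_x f x = `|a|%:E * \int[mu]_x f (a * x + c)%R)%E.
Proof.
move=> a0 mf f0.
rewrite (eq_measure_integral
  (mscale (`|a|%:nng)%R (nu a c))); last first.
  by move=> A mA _; exact: pushforward_affine.
rewrite ge0_integral_mscale//= ge0_integral_pushforward//.
Qed.


Lemma lebint_shift n (F : 'cV[R]_n -> \bar R) (c : 'cV[R]_n) :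
  measurable_fun setT F -> (forall v, 0 <= F v)%E ->
  lebint F = lebint (fun v => F (v + c)).
Proof.
elim: n F c => [|n IH] F c mF F0.
  by rewrite !lebint0; congr F; apply/matrixP => -[].
rewrite !lebintS.
rewrite (@integral_affine 1 (c ord0 ord0)) ?oner_neq0//; last 2 first.
- apply: (@measurable_lebint R _ R n (fun x v => F (col_mx x%:M v))) => //.
  by apply: (measurableT_comp mF); exact: measurable_col_mx.
- by move=> x; exact: lebint_ge0.
rewrite normr1 mul1e; apply: eq_integral => x _.
rewrite (IH _ (dsubmx (c : 'cV_(1 + n)))) //; last first.
  by apply: (measurableT_comp mF); exact: measurable_col_mx.
apply: eq_lebint => v; congr F.
rewrite -[c in RHS](@vsubmxK _ 1 n) (@add_col_mx _ 1 n 1) mul1r.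
apply: (congr1 (fun z : 'M[R]_(1,1) => col_mx z (v + dsubmx (c : 'cV_(1 + n))))).
rewrite raddfD/=; congr (_ + _).
by apply/matrixP => i j; rewrite !mxE !ord1/= ?eqxx ?mulr1n; congr (c _ _); apply/val_inj.
Qed.

(** The change of variables formula as a property of [A], so that it can be carried through matrix
    factorizations. *)
Definition linear_change n (A : 'M[R]_n) := forall F : 'cV[R]_n -> \bar R,
  measurable_fun setT F -> (forall v, 0 <= F v)%E ->
  lebint F = (`|\det A|%:E * lebint (fun v => F (A *m v)))%E.

Lemma linear_change_mul n (A B : 'M[R]_n) :
  linear_change A -> linear_change B -> linear_change (A *m B).
Proof.
move=> hA hB F mF F0; rewrite hA// hB//; last first.
  by apply: (measurableT_comp mF); exact: measurable_mulmx.
rewrite muleA -EFinM -normrM -det_mulmx.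
by under eq_lebint do rewrite mulmxA.
Qed.

(** The first coordinate is only scaled. Once it is fixed, the others undergo [B] and a translation,
    which leaves the inner integral unchanged. *)
Lemma linear_change_lower n (a : R) (c : 'cV[R]_n) (B : 'M[R]_n) :
  a != 0 -> linear_change B ->
  linear_change (block_mx a%:M 0 c B : 'M[R]_(1 + n)).
Proof.
move=> a0 hB F mF F0; rewrite det_lblock det_scalar1 !(@lebintS R n).
have mFc x : measurable_fun setT (fun v : 'cV[R]_n => F (col_mx x%:M v)).
  by apply: (measurableT_comp mF); exact: measurable_col_mx.
rewrite (@integral_affine a 0)//; last 2 first.
- apply: (@measurable_lebint R _ R n (fun x v => F (col_mx x%:M v))) => //.
  by apply: (measurableT_comp mF); exact: measurable_col_mx.
- by move=> x; exact: lebint_ge0.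
rewrite normrM EFinM -muleA; congr (_ * _)%E.
have mG : measurable_fun [set: R * 'cV[R]_n] (fun p =>
    F (block_mx a%:M 0 c B *m col_mx p.1%:M p.2)).
  by apply: (measurableT_comp mF); apply: measurable_mulmx;
     apply: measurable_col_mx.
rewrite -ge0_integralZl//; last 2 first.
- exact: (@measurable_lebint R _ R n
    (fun x v => F (block_mx a%:M 0 c B *m col_mx x%:M v))).
- by move=> x _; exact: lebint_ge0.
apply: eq_integral => x _.
rewrite (@lebint_shift _ _ (c *m x%:M))// hB//; last first.
  by apply: (measurableT_comp (mFc _)); apply: measurable_addmx.
congr (_ * _)%E; apply: eq_lebint => v; congr F.
by rewrite mul_block_col mul0mx !addr0 -scalar_mxM [in LHS]addrC.
Qed.

(** After Tonelli the first coordinate is integrated innermost, and there the shear is the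
    translation by [r *m v]. *)
Lemma linear_change_upper n (r : 'rV[R]_n) :
  linear_change (block_mx 1 r 0 1%:M : 'M[R]_(1 + n)).
Proof.
move=> F mF F0; rewrite det_ublock det1 det1 mulr1 normr1 mul1e !(@lebintS R n).
have mFc : measurable_fun [set: R * 'cV[R]_n] (fun p => F (col_mx p.1%:M p.2)).
  by apply: (measurableT_comp mF); exact: measurable_col_mx.
rewrite (@lebint_integral_swap R n (fun x v => F (col_mx x%:M v)))//.
rewrite (@lebint_integral_swap R n (fun x v =>
   F (block_mx 1 r 0 1%:M *m col_mx x%:M v)))//; last first.
  by apply: (measurableT_comp mF); apply: measurable_mulmx; exact: measurable_col_mx.
apply: eq_lebint => v.
rewrite (@integral_affine 1 ((r *m v) ord0 ord0)) ?oner_neq0//; last first.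
  by apply: (measurableT_comp mF); exact: measurable_col_mx.
rewrite normr1 mul1e; apply: eq_integral => x _; congr F.
rewrite mul_block_col mul0mx add0r mul1r mul1mx !mul1mx; congr col_mx.
by rewrite raddfD/= -mx11_scalar.
Qed.

(* Induction on n through A = [a 0; c C] [1 r; 0 1]; a vanishing pivot is first
   repaired by adding another row, so that no permutation is needed. *)
Lemma lebint_linear_change n (A : 'M[R]_n) : A \in unitmx -> linear_change A.
Proof.
elim: n A => [|n IH].
  move=> A _.
  by move=> F mF F0; rewrite !lebint0 det_mx00 normr1 mul1e; congr F;
     apply/matrixP => -[].
have pivot (B : 'M[R]_(1 + n)) : B \in unitmx -> B 0 0 != 0 -> linear_change B.
  move=> Bu a0; set a := B 0 0.
  have Bul : ulsubmx B = a%:M.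
    by rewrite [LHS]mx11_scalar !mxE; congr (B _ _)%:M; apply/val_inj.
  (* [C] is the Schur complement of the pivot; it inherits invertibility from [B]. *)
  pose r := a^-1 *: ursubmx B; pose C := drsubmx B - dlsubmx B *m r.
  have BE : B = block_mx a%:M 0 (dlsubmx B) C *m block_mx 1 r 0 1%:M.
    rewrite mulmx_block !mulmx0 !mulmx1 !addr0 mul_scalar_mx.
    by rewrite /r scalerA divff// scale1r addrC subrK -Bul submxK.
  have Cu : C \in unitmx.
    move: Bu; rewrite BE !unitmxE det_mulmx det_lblock det_ublock !det1 !mulr1.
    by rewrite unitrM => /andP[].
  rewrite BE; apply: linear_change_mul; last exact: linear_change_upper.
  by apply: linear_change_lower => //; exact: IH.
suff change1 (A : 'M[R]_(1 + n)) : A \in unitmx -> linear_change A by exact: change1.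
move=> Au; have [A00|] := eqVneq (A 0 0) 0; last exact: (pivot A).
(* Otherwise the whole first column vanishes, and so does the determinant. *)
have [j Aj] : exists j : 'I_n, A (rshift 1 j) 0 != 0.
  apply/existsP; apply: contraLR Au => /existsPn Aj.
  rewrite unitmxE (expand_det_col _ 0) big1 ?unitr0// => i _.
  rewrite (_ : A i 0 = 0) ?mul0r//.
  have [k ->|k ->] := fintype.split_ordP (i : 'I_(1 + n)).
    by rewrite ord1 -[RHS]A00; congr (A _ _); apply/val_inj.
  by have := Aj k; rewrite negbK => /eqP.
(* [E 1] adds row [rshift 1 j] to the first row, which makes the pivot nonzero; [E (-1)] undoes
   it. *)
pose E (s : R) : 'M[R]_(1 + n) := block_mx 1 (s *: delta_mx 0 j) 0 1%:M.
have EE : E (-1) *m E 1 = 1%:M.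
  rewrite mulmx_block !mulmx0 !mulmx1 !mul1mx !mul0mx !addr0 !add0r !scale1r.
  by rewrite scaleN1r subrr -scalar_mx_block.
have -> : A = E (-1) *m (E 1 *m A) by rewrite mulmxA EE mul1mx.
apply: linear_change_mul; first exact: linear_change_upper.
apply: pivot.
  rewrite unitmx_mul Au andbT unitmxE det_ublock !det1 mulr1 unitr1//.
rewrite mxE big_split_ord/= big_ord1.
rewrite [X in X + _](_ : _ = 0); last first.
  rewrite (_ : A _ _ = 0) ?mulr0// -[RHS]A00; congr (A _ _); exact/val_inj.
have E1 i : E 1 0 (rshift 1 i) = (i == j)%:R.
  rewrite -[LHS](_ : E 1 (lshift n 0) (rshift 1 i) = _).
    by rewrite block_mxEur scale1r mxE.
  by congr (E 1 _ _); apply/val_inj.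
rewrite add0r (bigD1 j)//= big1 ?addr0 ?E1 ?eqxx ?mul1r// => i /negbTE ij.
by rewrite E1 ij mul0r.
Qed.

End lebint_change.

(** * Symmetric square roots *)

(** A multiple of the product vanishing at the old nodes corrects the value at a new one; a repeated
    node calls for no correction. *)
Lemma interpolation (F : fieldType) (s : seq F) (g : F -> F) :
  exists p : {poly F}, {in s, forall x, p.[x] = g x}.
Proof.
elim: s => [|x s [p pE]]; first by exists 0.
have [xs|xs] := boolP (x \in s).
  by exists p => y; rewrite inE => /predU1P[->|]; exact: pE.
pose q : {poly F} := \prod_(y <- s) ('X - y%:P).
have q0 y : (q.[y] == 0) = (y \in s) by rewrite -[LHS]/(root q y) root_prod_XsubC.
exists (p + ((g x - p.[x]) / q.[x]) *: q) => y; rewrite inE !hornerE => /predU1P[->|ys].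
  by rewrite divfK ?q0// addrC subrK.
by have /eqP -> := etrans (q0 y) ys; rewrite mulr0 addr0 pE.
Qed.

Section posdef.
Context {R : realType}.

Lemma quadformE n (A : 'M[R]_n) v : A^T = A -> quadform (A *m A) v = sqnorm (A *m v).
Proof.
move=> AT; rewrite /quadform mulmxA -{1}AT -trmx_mul -mulmxA mxE /sqnorm.
by apply: eq_bigr => i _; rewrite mxE expr2.
Qed.

Lemma sqnorm_ge0 n (v : 'cV[R]_n) : 0 <= sqnorm v.
Proof. by apply: sumr_ge0 => i _; exact: sqr_ge0. Qed.

Lemma sqnorm_eq0 n (v : 'cV[R]_n) : (sqnorm v == 0) = (v == 0).
Proof.
rewrite /sqnorm psumr_eq0; last by move=> i _; exact: sqr_ge0.
apply/allP/eqP => [v0|-> i _]; last by rewrite mxE expr0n/=.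
apply/matrixP => i j; rewrite ord1 mxE; apply/eqP.
by have := v0 i (mem_index_enum _); rewrite sqrf_eq0.
Qed.

Lemma sqnormE n (v : 'cV[R]_n) : sqnorm v = (v^T *m v) ord0 ord0.
Proof. by rewrite mxE; apply: eq_bigr => i _; rewrite mxE expr2. Qed.

(** The quadratic form would vanish at a kernel vector. *)
Lemma posdef_unit n (A : 'M[R]_n) : posdef A -> A \in unitmx.
Proof.
move=> [_ A0]; rewrite -unitmx_tr unitmxE unitfE; apply/det0P => -[v v0 vA].
have := A0 v^T; rewrite trmx_eq0 v0 /quadform trmxK => /(_ isT).
suff -> : v *m A *m v^T = 0 by rewrite mxE ltxx.
by rewrite -mulmxA -[A *m _]trmxK trmx_mul trmxK vA trmx0 mulmx0.
Qed.

Lemma posdef_inv n (A : 'M[R]_n) : posdef A -> posdef (invmx A).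
Proof.
move=> Apd; have Au := posdef_unit Apd; case: Apd => [AT A0].
have iT : (invmx A)^T = invmx A by rewrite trmx_inv AT.
split=> // v v0; have := A0 (invmx A *m v).
have /[swap]/[apply] : invmx A *m v != 0.
  by apply: contra v0 => /eqP v0; rewrite -[v](mulKVmx Au) v0 mulmx0.
by rewrite /quadform trmx_mul iT !mulmxA mulmxKV// -!mulmxA.
Qed.

Lemma posdefD n (A B : 'M[R]_n) : posdef A -> posdef B -> posdef (A + B).
Proof.
move=> [AT A0] [BT B0]; split; first by rewrite raddfD/= AT BT.
move=> v v0; rewrite /quadform mulmxDr mulmxDl mxE.
by apply: addr_gt0; [exact: A0|exact: B0].
Qed.

Lemma posdef_eigenvalue_gt0 n (A : 'M[R]_n) a : posdef A -> eigenvalue A a -> 0 < a.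
Proof.
move=> [AT A0] /eigenvalueP[v vA v0]; have := A0 v^T.
rewrite trmx_eq0 v0 => /(_ isT); rewrite /quadform trmxK vA -scalemxAl mxE.
rewrite -[v in v *m _]trmxK -sqnormE pmulr_lgt0// lt0r sqnorm_ge0 andbT.
by rewrite sqnorm_eq0 trmx_eq0.
Qed.

Lemma horner_mx_sym n (A : 'M[R]_n.+1) p : A^T = A -> (horner_mx A p)^T = horner_mx A p.
Proof.
move=> AT; elim/poly_ind: p => [|p c IH]; first by rewrite rmorph0 trmx0.
rewrite rmorphD rmorphM/= horner_mx_X horner_mx_C raddfD/= tr_scalar_mx.
by rewrite trmx_mul IH AT; congr (_ + _); exact: (comm_mx_horner p (comm_mx_refl A)).
Qed.

(* The root is a polynomial in A: interpolate the fourth root on the (positive)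
   eigenvalues; since A is diagonalizable over R[i], p(A)^4 = A. *)
Lemma posdef_sqrtm_exists n (A : 'M[R]_n) : (0 < n)%N -> posdef A ->
  exists S, is_sqrtm A S.
Proof.
case: n A => // n A _ Apd; have AT : A^T = A by case: Apd.
pose f := real_complex R.
pose Ac := map_mx f A.
have Asym : Ac \is symmetricmx.
  apply/is_hermitianmxP; rewrite expr0 scale1r map_mx_id//.
  by apply/matrixP => i j; rewrite !mxE -[in LHS]AT mxE.
have Areal : Ac \is a mxOver Num.real.
  by apply/mxOverP => i j; rewrite mxE complex_real.
(* Seen over [R[i]], a real symmetric matrix is Hermitian, hence diagonalizable with a real
   diagonal. *)
have Aherm := realsym_hermsym Asym Areal.
have /orthomx_spectralP := hermitian_normalmx Aherm.
have := hermitian_spectral_diag_real Aherm.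
have := spectral_unit Ac.
move: (spectralmx Ac) (spectral_diag Ac) => P D Pu Dreal AE.
have [d dE] : exists d : 'rV[R]_n.+1, D = map_mx f d.
  exists (map_mx (@complex.Re R) D); apply/matrixP => i j; rewrite !mxE.
  by move/mxOverP : Dreal => /(_ i j) /complex_realP[k ->].
have d0 i : 0 < d 0 i.
  (* The rows of [P] are left eigenvectors of [Ac], and [A] has the same characteristic polynomial
     up to the embedding [f]. *)
  apply: (posdef_eigenvalue_gt0 Apd).
  rewrite eigenvalue_root_char -(fmorph_root f) map_char_poly -eigenvalue_root_char.
  apply/eigenvalueP; exists (row i P).
    rewrite -/Ac AE dE -row_mul !mulmxA mulmxV// mul1mx row_mul.
    by rewrite row_diag_mx -scalemxAl -rowE mxE.
  apply/negP => /eqP r0; have := row_free_unit P; rewrite Pu => /row_freeP[B PB].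
  have := congr1 (row i) PB; rewrite row_mul r0 mul0mx => /rowP/(_ i).
  by rewrite !mxE eqxx => /esym/eqP; rewrite oner_eq0.
have [p pE] := interpolation (codom (d 0)) (fun x => Num.sqrt (Num.sqrt x)).
pose T := horner_mx A p.
have TT : T^T = T by exact: horner_mx_sym.
(* A fourth root [T] is used because the quadratic form of the square of a symmetric matrix is a sum
   of squares, hence nonnegative. *)
exists (T *m T); split; first by rewrite trmx_mul TT.
split; first by move=> v; rewrite quadformE// sqnorm_ge0.
pose q := p * p * (p * p).
rewrite (_ : T *m T *m (T *m T) = horner_mx A q); last first.
  by rewrite !(rmorphM (horner_mx A)).
have qE i : q.[d 0 i] = d 0 i.
  rewrite /q !hornerM pE ?codom_f// -!expr2 sqr_sqrtr ?sqrtr_ge0//.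
  by rewrite sqr_sqrtr// ltW.
have Dq : map_mx (horner (map_poly f q)) D = D.
  by apply/rowP => i; rewrite dE !mxE horner_map qE.
apply: (@map_mx_inj _ _ f); rewrite map_horner_mx -/Ac {1}AE.
rewrite -{2}(invmxK P) horner_mx_uconj ?unitmx_inv// invmxK horner_mx_diag.
by rewrite Dq [RHS]AE.
Qed.

Lemma sqrtmP n (A : 'M[R]_n) : (0 < n)%N -> posdef A -> is_sqrtm A (sqrtm A).
Proof.
move=> n0 /(posdef_sqrtm_exists n0)[S AS].
by rewrite /sqrtm; case: xgetP => [y _ //|/(_ S)].
Qed.

End posdef.

(** * Standard Gaussian densities *)

Section gauss.
Context {R : realType}.
Local Notation mu := (@lebesgue_measure R).

Lemma gauss_pdf_sqnorm n (m v : 'cV[R]_n) :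
  gauss_pdf m 1%:M v = Num.sqrt (pi *+ 2) ^- n * expR (- sqnorm (v - m) / 2).
Proof.
rewrite /gauss_pdf det1 mulr1 invmx1 /quadform mulmx1 -sqnormE; congr (_^-1 * _).
elim: n {m v} => [|n IH]; first by rewrite !expr0 sqrtr1.
by rewrite !exprS sqrtrM ?IH// mulrn_wge0// pi_ge0.
Qed.

(** Independence of the coordinates, which reduces mass estimates to one dimension. *)
Lemma gauss_pdf_prod n (m v : 'cV[R]_n) :
  gauss_pdf m 1%:M v = \prod_(i < n) normal_pdf (m i ord0) 1 (v i ord0).
Proof.
rewrite gauss_pdf_sqnorm.
under eq_bigr do rewrite normal_pdfE ?oner_neq0//= /normal_peak /normal_fun expr1n mul1r.
rewrite big_split/= prodr_const card_ord exprVn; congr (_ * _).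
rewrite -(big_morph _ (@expRD R) (@expR0 R)); congr expR.
rewrite mulNr mulr_suml -sumrN; apply: eq_bigr => i _.
by rewrite !mxE mulNr.
Qed.

Lemma gauss_pdf_ge0 n (m : 'cV[R]_n) (S : 'M[R]_n) v : 0 <= gauss_pdf m S v.
Proof. by rewrite mulr_ge0 ?expR_ge0// invr_ge0 sqrtr_ge0. Qed.

Section measurability.
Context d (T : measurableType d).

Lemma measurable_sqnorm n (f : T -> 'cV[R]_n) : measurable_fun [set: T] f ->
  measurable_fun [set: T] (fun t => sqnorm (f t)).
Proof.
move=> mf; apply: measurable_sum => i; apply: measurable_funX.
exact: measurable_coord.
Qed.

Lemma measurable_quadform n (A : 'M[R]_n) (f : T -> 'cV[R]_n) :
  measurable_fun [set: T] f -> measurable_fun [set: T] (fun t => quadform A (f t)).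
Proof.
move=> mf; rewrite /quadform.
under eq_fun do rewrite -mulmxA mxE.
apply: measurable_sum => i; under eq_fun do rewrite mxE.
apply: measurable_funM; first exact: measurable_coord.
by apply: measurable_coord; exact: measurable_mulmx.
Qed.

Lemma measurable_oppmx n (f : T -> 'cV[R]_n) :
  measurable_fun [set: T] f -> measurable_fun [set: T] (fun t => - f t).
Proof.
move=> mf; apply: measurable_colP => i; under eq_fun do rewrite mxE.
by apply: measurableT_comp => //; exact: measurable_coord.
Qed.

Lemma measurable_gauss_pdf n (S : 'M[R]_n) (f g : T -> 'cV[R]_n) :
  measurable_fun [set: T] f -> measurable_fun [set: T] g ->
  measurable_fun [set: T] (fun t => gauss_pdf (f t) S (g t)).
Proof.
move=> mf mg; apply: measurable_funM => //; apply: measurableT_comp => //.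
apply: measurable_funM => //; apply: measurableT_comp => //.
by apply: measurable_quadform; apply: measurable_addmx => //; exact: measurable_oppmx.
Qed.

Lemma measurable_restr (b : T -> bool) (f : T -> R) :
  measurable_fun [set: T] b -> measurable_fun [set: T] f ->
  measurable_fun [set: T] (fun t => if b t then (f t)%:E else 0%E).
Proof. by move=> mb mf; apply: measurable_fun_ifT => //; exact/measurable_EFinP. Qed.

End measurability.

Lemma col_cons0 n x (v : 'cV[R]_n) :
  (col_mx x%:M v : 'cV[R]_n.+1) ord0 ord0 = x.
Proof.
transitivity ((col_mx x%:M v : 'cV[R]_(1 + n)) (lshift n ord0) ord0).
  by congr (col_mx _ _ _ _); exact: val_inj.
by rewrite col_mxEu mxE eqxx.
Qed.

Lemma col_consS n x (v : 'cV[R]_n) i :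
  (col_mx x%:M v : 'cV[R]_n.+1) (lift ord0 i) ord0 = v i ord0.
Proof.
transitivity ((col_mx x%:M v : 'cV[R]_(1 + n)) (rshift 1 i) ord0).
  by congr (col_mx _ _ _ _); exact: val_inj.
by rewrite col_mxEd.
Qed.

Lemma lebint_prod n (f : 'I_n -> R -> R) (c : 'I_n -> R) :
  (forall i, measurable_fun setT (f i)) -> (forall i x, 0 <= f i x) ->
  (forall i, \int[mu]_x (f i x)%:E = (c i)%:E)%E ->
  lebint (fun v : 'cV[R]_n => (\prod_i f i (v i ord0))%:E) = (\prod_i c i)%:E.
Proof.
elim: n f c => [|n IH] f c mf f0 fc; first by rewrite lebint0 !big_ord0.
rewrite lebintS big_ord_recl EFinM -fc.
have p0 (v : 'cV[R]_n) : 0 <= \prod_i f (lift ord0 i) (v i ord0).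
  by apply: prodr_ge0 => i _.
have IH' := IH _ _ (fun i => mf (lift ord0 i)) (fun i => f0 (lift ord0 i))
  (fun i => fc (lift ord0 i)).
rewrite muleC -ge0_integralZl//; first last.
- by rewrite lee_fin; apply: prodr_ge0 => i _; rewrite -lee_fin -fc integral_ge0// => x _; rewrite lee_fin.
- by move=> x _; rewrite lee_fin.
- by apply/measurable_EFinP; exact: mf.
apply: eq_integral => x _; rewrite -IH' muleC -lebintZl ?lee_fin//; last first.
  by apply/measurable_EFinP; apply: measurable_prod => i _;
    apply: (measurableT_comp (mf _)); exact: measurable_coor.
apply: eq_lebint => v; rewrite big_ord_recl EFinM; rewrite col_cons0; congr (_ * (_)%:E)%E.
by apply: eq_bigr => i _; rewrite col_consS.
Qed.

Lemma lebint_gauss n (m : 'cV[R]_n) : lebint (fun v => (gauss_pdf m 1%:M v)%:E) = 1%E.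
Proof.
under eq_lebint do rewrite gauss_pdf_prod.
rewrite (lebint_prod (f := fun i => normal_pdf (m i ord0) 1) (c := fun=> 1)).
- by rewrite prodr_const expr1n.
- by move=> i; exact: measurable_normal_pdf.
- by move=> i x; exact: normal_pdf_ge0.
- by move=> i; rewrite integral_normal_pdf// oner_neq0.
Qed.

(** The noncentral chi-squared CDF with an arbitrary mean and extended real values; [ncchi2_cdfE]
    links it to [ncchi2_cdf]. *)
Definition ball_prob n (M : R) (m : 'cV[R]_n) : \bar R :=
  lebint (fun v => if sqnorm v <= M then (gauss_pdf m 1%:M v)%:E else 0%E).

Lemma measurable_ball_prob d (T : measurableType d) n M (f : T -> 'cV[R]_n) :
  measurable_fun [set: T] f -> measurable_fun [set: T] (fun t => ball_prob M (f t)).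
Proof.
move=> mf; apply: (@measurable_lebint _ _ _ _ (fun t v =>
  if sqnorm v <= M then (gauss_pdf (f t) 1%:M v)%:E else 0%E)).
  apply: measurable_restr.
    apply: measurable_fun_ler => //; apply: measurable_sqnorm.
    exact: measurable_snd.
  by apply: measurable_gauss_pdf => //; exact: (measurableT_comp mf).
by move=> t v; case: ifP => // _; rewrite lee_fin gauss_pdf_ge0.
Qed.

Lemma ball_prob_ge0 n M (m : 'cV[R]_n) : (0 <= ball_prob M m)%E.
Proof. by apply: lebint_ge0 => v; case: ifP => // _; rewrite lee_fin gauss_pdf_ge0. Qed.

Lemma ball_prob_le1 n M (m : 'cV[R]_n) : (ball_prob M m <= 1)%E.
Proof.
rewrite -(lebint_gauss m); apply: le_lebint.
- apply: measurable_restr; last exact: measurable_gauss_pdf.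
  by apply: measurable_fun_ler => //; exact: measurable_sqnorm.
- by apply/measurable_EFinP; exact: measurable_gauss_pdf.
- by move=> v; case: ifP => // _; rewrite lee_fin gauss_pdf_ge0.
- by move=> v; case: ifP => // _; rewrite lee_fin gauss_pdf_ge0.
Qed.

Lemma ball_prob_fin n M (m : 'cV[R]_n) : ball_prob M m \is a fin_num.
Proof.
rewrite ge0_fin_numE ?ball_prob_ge0//.
exact: le_lt_trans (ball_prob_le1 _ _) (ltry _).
Qed.

Lemma sqnorm_orthogonal n (Q : 'M[R]_n) v : Q^T *m Q = 1%:M -> sqnorm (Q *m v) = sqnorm v.
Proof. by move=> QQ; rewrite !sqnormE trmx_mul mulmxA -[_ *m Q]mulmxA QQ mulmx1. Qed.

Lemma orthogonal_map n (x y : 'cV[R]_n) : sqnorm x = sqnorm y ->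
  exists2 Q : 'M[R]_n, Q^T *m Q = 1%:M & Q *m x = y.
Proof.
move=> xy; have [->|nxy] := eqVneq x y.
  by exists 1%:M; rewrite ?trmx1 mul1mx.
(* Householder reflection along w = x - y *)
pose w := x - y; pose s := sqnorm w.
have s0 : s != 0 by rewrite sqnorm_eq0 subr_eq0.
have wwE : w^T *m w = s%:M.
  by rewrite [LHS]mx11_scalar -sqnormE.
(* Equal norms give |x - y|^2 = 2 (x - y)^T x, so the reflection sends [x] to [x - w], which is
   [y]. *)
have wxE : w^T *m x = (s / 2)%:M.
  rewrite [LHS]mx11_scalar; congr (_%:M).
  have -> : (w^T *m x) 0 0 = \sum_i w i 0 * x i 0 by rewrite mxE; apply: eq_bigr => i _; rewrite mxE.
  have e : \sum_i (x i 0 ^+ 2 - y i 0 ^+ 2) = 0.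
    by rewrite sumrB -[X in X - _]/(sqnorm x) xy subrr.
  apply: (mulIf (x := 2)); first by rewrite pnatr_eq0.
  rewrite divfK ?pnatr_eq0// mulr_suml -[RHS]addr0 -[in RHS]e /s /sqnorm -big_split/=.
by apply: eq_bigr => i _; rewrite !mxE; ring.
pose N := w *m w^T; pose Q := 1%:M - (2 / s) *: N.
have NN : N *m N = s *: N.
  by rewrite /N mulmxA -[w *m w^T *m w]mulmxA wwE mul_mx_scalar -scalemxAl.
have QT : Q^T = Q.
  by apply/matrixP => i j; rewrite !mxE eq_sym; congr (_ - _ * _);
    apply: eq_bigr => k _; rewrite !mxE mulrC.
exists Q.
  rewrite QT /Q mulmxBl mul1mx mulmxBr mulmx1 -scalemxAl -scalemxAr NN !scalerA.
  rewrite opprB -addrA -[RHS]addr0 -scalerBl -scaleNr -scalerDl.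
  congr (_ + _); apply/eqP; rewrite scaler_eq0; apply/orP; left.
  by apply/eqP; field.
rewrite mulmxBl mul1mx -scalemxAl -mulmxA wxE mul_mx_scalar scalerA.
rewrite (_ : 2 / s * (s / 2) = 1); last by field.
by rewrite scale1r /w subKr.
Qed.

Lemma ball_prob_orthogonal n M (Q : 'M[R]_n) m : Q^T *m Q = 1%:M ->
  ball_prob M (Q *m m) = ball_prob M m.
Proof.
move=> QQ.
have dQ : `|\det Q| = 1.
  have /eqP := congr1 determinant QQ; rewrite det_mulmx det_tr det1 -expr2.
  by rewrite sqrf_eq1 => /orP[]/eqP->; rewrite ?normrN normr1.
have Qu : Q \in unitmx.
  by rewrite unitmxE unitfE -normr_eq0 dQ oner_neq0.
rewrite /ball_prob (lebint_linear_change Qu).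
- rewrite dQ mul1e; apply: eq_lebint => v; rewrite sqnorm_orthogonal//.
  by rewrite !gauss_pdf_sqnorm -mulmxBr sqnorm_orthogonal.
- apply: measurable_restr; last exact: measurable_gauss_pdf.
  by apply: measurable_fun_ler => //; exact: measurable_sqnorm.
- by move=> v; case: ifP => // _; rewrite lee_fin gauss_pdf_ge0.
Qed.

(** An orthogonal map takes the mean to the first axis, where [ncchi2_cdf] places it. *)
Lemma ncchi2_cdfE n M (m : 'cV[R]_n.+1) :
  (ncchi2_cdf n.+1 M (sqnorm m))%:E = ball_prob M m.
Proof.
set e : 'cV[R]_n.+1 := \col_i (if (i : nat) == 0%N then Num.sqrt (sqnorm m) else 0).
have /orthogonal_map[Q QQ QE] : sqnorm m = sqnorm e.
  rewrite [RHS]/sqnorm big_ord_recl !mxE/= sqr_sqrtr ?sqnorm_ge0// big1 ?addr0//.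
  by move=> i _; rewrite mxE/= expr0n.
rewrite -(ball_prob_orthogonal M m QQ) QE -(fineK (ball_prob_fin M e)).
by rewrite /ncchi2_cdf.
Qed.

End gauss.

(** * Mass of balls and shells *)

Section ball_prob_bounds.
Context {R : realType}.
Local Notation mu := (@lebesgue_measure R).

Lemma measurable_shell d (T : measurableType d) n M1 M2 (f : T -> 'cV[R]_n) :
  measurable_fun [set: T] f ->
  measurable_fun [set: T] (fun t => M1 < sqnorm (f t) <= M2).
Proof.
move=> mf; apply: measurable_and.
  by apply: measurable_fun_ltr => //; exact: measurable_sqnorm.
by apply: measurable_fun_ler => //; exact: measurable_sqnorm.
Qed.

(** The increment of [ball_prob] from [M1] to [M2]: upper bounds on it yield continuity, lower
    bounds strict growth. *)
Definition shell_prob n (M1 M2 : R) (m : 'cV[R]_n) : \bar R :=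
  lebint (fun v => if M1 < sqnorm v <= M2 then (gauss_pdf m 1%:M v)%:E else 0%E).

Lemma shell_prob_ge0 n M1 M2 (m : 'cV[R]_n) : (0 <= shell_prob M1 M2 m)%E.
Proof. by apply: lebint_ge0 => v; case: ifP => // _; rewrite lee_fin gauss_pdf_ge0. Qed.

Lemma ball_prob_shell n M1 M2 (m : 'cV[R]_n) : M1 <= M2 ->
  ball_prob M2 m = (ball_prob M1 m + shell_prob M1 M2 m)%E.
Proof.
move=> M12; rewrite /ball_prob /shell_prob -lebintD.
- apply: eq_lebint => v; case: (leP (sqnorm v) M1) => [h|h] /=.
    by rewrite (le_trans h M12) adde0.
  by rewrite add0e.
- apply: measurable_restr; last exact: measurable_gauss_pdf.
  by apply: measurable_fun_ler => //; exact: measurable_sqnorm.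
- apply: measurable_restr; last exact: measurable_gauss_pdf.
  exact: measurable_shell.
- by move=> v; case: ifP => // _; rewrite lee_fin gauss_pdf_ge0.
- by move=> v; case: ifP => // _; rewrite lee_fin gauss_pdf_ge0.
Qed.

Lemma normal_pdf_le1 (m x : R) : normal_pdf m 1 x <= 1.
Proof.
apply: (le_trans (normal_pdf_ub _ _ (oner_neq0 R))).
have p2 : (1 : R) <= pi *+ 2 by rewrite mulr2n; have := pi_ge2 R; lra.
have s1 : 1 <= Num.sqrt (pi *+ 2) :> R by rewrite -[leLHS]sqrtr1 ler_wsqrtr.
by rewrite /normal_peak expr1n mul1r invf_le1// (lt_le_trans ltr01 s1).
Qed.

Lemma sqrtrB_le (a b : R) : a <= b -> Num.sqrt b - Num.sqrt a <= Num.sqrt (b - a).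
Proof.
(* Negative arguments do occur, as the bounds [M1 - sqnorm v] of a slice of a shell; [Num.sqrt] is 0
   there. *)
move=> ab; have [a0|a0] := leP a 0.
  by rewrite (ler0_sqrtr a0) subr0 ler_wsqrtr// lerBrDl; lra.
have sa : 0 <= Num.sqrt a by exact: sqrtr_ge0.
have sab : Num.sqrt a <= Num.sqrt b by exact: ler_wsqrtr.
have eb : Num.sqrt b ^+ 2 = b by rewrite sqr_sqrtr//; lra.
have ea : Num.sqrt a ^+ 2 = a by rewrite sqr_sqrtr//; lra.
rewrite -(@ler_pXn2r _ 2)// ?nnegrE ?sqrtr_ge0 ?subr_ge0//.
by rewrite sqr_sqrtr ?subr_ge0// -{2}eb -{2}ea; nra.
Qed.

(** The density is at most 1, so the integral is at most the total length of the two intervals where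
    [|x|] lies between the roots of [a] and [b]. *)
Lemma integral_sqr_shell (a b m : R) : a <= b ->
  (\int[mu]_x (if (a < x ^+ 2 <= b)%R then (normal_pdf m 1 x)%:E else 0)
    <= (2 * Num.sqrt (b - a))%:E)%E.
Proof.
move=> ab; pose sa := Num.sqrt a; pose sb := Num.sqrt b.
have sab : sa <= sb by exact: ler_wsqrtr.
pose I1 := `[- sb, - sa]%classic : set R; pose I2 := `[sa, sb]%classic : set R.
apply: (@le_trans _ _ (\int[mu]_x ((\1_I1 x)%:E + (\1_I2 x)%:E))%E).
  apply: ge0_le_integral => //.
  - by move=> x _; case: ifP => // _; rewrite lee_fin normal_pdf_ge0.
  - apply: measurable_restr; last exact: measurable_normal_pdf.
    apply: measurable_and.
      by apply: measurable_fun_ltr => //; exact: measurable_funX.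
    by apply: measurable_fun_ler => //; exact: measurable_funX.
  - by apply: emeasurable_funD; apply/measurable_EFinP; exact: measurable_indic (measurable_itv _).
  move=> x _; rewrite -EFinD; case: ifP => [/andP[ax xb]|_]; last first.
    by rewrite lee_fin addr_ge0.
  have h1 : sa <= `|x| by rewrite -sqrtr_sqr ler_wsqrtr// ltW.
  have h2 : `|x| <= sb by rewrite -sqrtr_sqr ler_wsqrtr.
  rewrite lee_fin (le_trans (normal_pdf_le1 _ _))// !indicE.
  have [x0|x0] := leP 0 x.
    have -> : x \in I2.
      by apply/mem_set; rewrite /I2/= in_itv/= -(ger0_norm x0) h1 h2.
    by rewrite lerDr ler0n.
  have -> : x \in I1; last by rewrite lerDl ler0n.
  apply/mem_set; rewrite /I1/= in_itv/=.
  by move: h1 h2; rewrite (ltr0_norm x0) => h1 h2; apply/andP; split; lra.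
rewrite ge0_integralD//; last 2 first.
- by apply/measurable_EFinP; exact: measurable_indic (measurable_itv _).
- by apply/measurable_EFinP; exact: measurable_indic (measurable_itv _).
have mI1 : measurable I1 by exact: measurable_itv.
have mI2 : measurable I2 by exact: measurable_itv.
rewrite !integral_indic// !setIT /I1 /I2/= !lebesgue_measure_itv/= !lte_fin.
have := sqrtrB_le ab; rewrite -/sa -/sb => h.
have s0 := sqrtr_ge0 (b - a).
by case: ifP => _; case: ifP => _; rewrite -?EFinB -?EFinD lee_fin; lra.
Qed.

Lemma sqnorm_cons n x (v : 'cV[R]_n) :
  sqnorm (col_mx x%:M v : 'cV[R]_n.+1) = x ^+ 2 + sqnorm v.
Proof.
rewrite /sqnorm big_ord_recl col_cons0; congr (_ + _).
by apply: eq_bigr => i _; rewrite col_consS.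
Qed.

Lemma gauss_pdf_cons n (m : 'cV[R]_n.+1) x (v : 'cV[R]_n) :
  gauss_pdf m 1%:M (col_mx x%:M v : 'cV[R]_n.+1) =
  normal_pdf (m ord0 ord0) 1 x *
  gauss_pdf (\col_i m (lift ord0 i) ord0) 1%:M v.
Proof.
rewrite !gauss_pdf_prod big_ord_recl col_cons0; congr (_ * _).
by apply: eq_bigr => i _; rewrite col_consS mxE.
Qed.

(* Integrating the first coordinate first: a shell of width M2 - M1 meets each
   line in a set of length at most 2 sqrt(M2 - M1). *)
Lemma shell_prob_le n M1 M2 (m : 'cV[R]_n.+1) : M1 <= M2 ->
  (shell_prob M1 M2 m <= (2 * Num.sqrt (M2 - M1))%:E)%E.
Proof.
move=> M12; rewrite /shell_prob lebintS.
pose m' : 'cV[R]_n := \col_i m (lift ord0 i) ord0.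
pose f (x : R) (v : 'cV[R]_n) : \bar R :=
  if M1 - sqnorm v < x ^+ 2 <= M2 - sqnorm v
  then (normal_pdf (m ord0 ord0) 1 x)%:E else 0%E.
have mf : measurable_fun [set: R * 'cV[R]_n] (fun p => f p.1 p.2).
  apply: measurable_restr.
    apply: measurable_and; [apply: measurable_fun_ltr|apply: measurable_fun_ler].
    - by apply: measurable_funB => //; exact: measurable_sqnorm.
    - by apply: measurable_funX; exact: measurable_fst.
    - by apply: measurable_funX; exact: measurable_fst.
    - by apply: measurable_funB => //; exact: measurable_sqnorm.
  exact: (measurableT_comp (measurable_normal_pdf _ _)).
have f0 x v : (0 <= f x v)%E by rewrite /f; case: ifP => // _; rewrite lee_fin normal_pdf_ge0.
have mg : measurable_fun [set: 'cV[R]_n] (fun v => (gauss_pdf m' 1%:M v)%:E).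
  by apply/measurable_EFinP; exact: measurable_gauss_pdf.
have g0 v : (0 <= (gauss_pdf m' 1%:M v)%:E)%E by rewrite lee_fin gauss_pdf_ge0.
under eq_integral => x _.
  rewrite (_ : lebint _ = lebint (fun v => (gauss_pdf m' 1%:M v)%:E * f x v)%E); last first.
    apply: eq_lebint => v; rewrite sqnorm_cons gauss_pdf_cons /f ltrBlDr lerBrDr.
    by case: ifP; rewrite ?mule0// -EFinM mulrC.
  over.
have mgf : measurable_fun [set: R * 'cV[R]_n]
    (fun p => (gauss_pdf m' 1%:M p.2)%:E * f p.1 p.2)%E.
  by apply: emeasurable_funM => //; exact: (measurableT_comp mg).
rewrite (@lebint_integral_swap R n
  (fun x v => (gauss_pdf m' 1%:M v)%:E * f x v)%E)//; last first.
  by move=> x v; rewrite mule_ge0.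
(* The bound is spread over the Gaussian mass 1 of the remaining coordinates, so that the integrands
   can be compared pointwise. *)
have -> : (2 * Num.sqrt (M2 - M1))%:E = lebint (fun v : 'cV[R]_n =>
    (2 * Num.sqrt (M2 - M1))%:E * (gauss_pdf m' 1%:M v)%:E)%E.
  by rewrite lebintZl ?lebint_gauss ?mule1 ?lee_fin ?mulr_ge0 ?sqrtr_ge0.
apply: le_lebint.
- apply: (@measurable_fun_fubini_tonelli_F _ _ 'cV[R]_n (measurableTypeR R) R mu
    (fun p => (gauss_pdf m' 1%:M p.1)%:E * f p.2 p.1)%E).
    apply: emeasurable_funM; first exact: (measurableT_comp mg).
    by apply: (measurable_comp2 mf); [exact: measurable_snd|exact: measurable_fst].
  by move=> p; rewrite mule_ge0.
- exact: emeasurable_funM.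
- by move=> v; apply: integral_ge0 => x _; rewrite mule_ge0.
- move=> v; rewrite ge0_integralZl//; last first.
    exact: (measurable_fun_pair1 v mf).
  rewrite muleC; apply: lee_wpmul2r => //.
  rewrite (le_trans (integral_sqr_shell _ _))// ?lerB// lee_fin.
  by rewrite opprB addrA subrK.
Qed.

End ball_prob_bounds.

(** * Lower bounds on Gaussian mass, uniform over bounded means *)

Section ball_prob_limits.
Context {R : realType}.
Local Notation mu := (@lebesgue_measure R).

Lemma ler_sqrt_sqnorm n (m : 'cV[R]_n) L i : sqnorm m <= L -> `|m i ord0| <= Num.sqrt L.
Proof.
move=> mL; rewrite -sqrtr_sqr ler_wsqrtr// (le_trans _ mL)// /sqnorm (bigD1 i)//=.
by rewrite lerDl sumr_ge0// => j _; exact: sqr_ge0.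
Qed.

(* The shell contains the cube ]sqrt(M1/n), sqrt(M2/n)]^n. *)
Lemma shell_prob_ge n (M1 M2 L : R) : 0 <= M1 -> M1 < M2 ->
  exists2 c : R, 0 < c & forall m : 'cV[R]_n.+1, sqnorm m <= L ->
    (c%:E <= shell_prob M1 M2 m)%E.
Proof.
move=> M10 M12.
have N0 : 0 < n.+1%:R :> R by rewrite ltr0n.
pose a := Num.sqrt (M1 / n.+1%:R); pose b := Num.sqrt (M2 / n.+1%:R).
have a0 : 0 <= a by exact: sqrtr_ge0.
have M20 : 0 <= M2 by lra.
have a2 : a ^+ 2 * n.+1%:R = M1 by rewrite sqr_sqrtr ?divr_ge0// divfK ?gt_eqF.
have b2 : b ^+ 2 * n.+1%:R = M2 by rewrite sqr_sqrtr ?divr_ge0// divfK ?gt_eqF.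
have ab : a < b by rewrite ltr_sqrt ?divr_gt0 ?ltr_pM2r ?invr_gt0//; lra.
(* A point of []a, b]] is within [b + Num.sqrt L] of each coordinate of the mean, so [k] bounds the
   one-dimensional densities from below. *)
pose k := normal_peak 1 * expR (- (b + Num.sqrt L) ^+ 2 / 2) : R.
have k0 : 0 < k by rewrite mulr_gt0 ?expR_gt0// normal_peak_gt0// oner_neq0.
pose I := `]a, b]%classic : set R.
have mI : measurable I by exact: measurable_itv.
pose f (i : 'I_n.+1) (x : R) : R := k * \1_I x.
have mf i : measurable_fun setT (f i).
  by apply: measurable_funM => //; exact: measurable_indic.
have f0 i x : 0 <= f i x by rewrite mulr_ge0// ltW.
have fI i : (\int[mu]_x (f i x)%:E = (k * (b - a))%:E)%E.
  under eq_integral do rewrite /f EFinM.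
  rewrite ge0_integralZl//; last 2 first.
  - by apply/measurable_EFinP; exact: measurable_indic.
  - by rewrite lee_fin ltW.
  by rewrite integral_indic// setIT /I/= lebesgue_measure_itv/= lte_fin ab -EFinB.
exists (\prod_(i < n.+1) (k * (b - a))).
  by apply: prodr_gt0 => i _; rewrite mulr_gt0// subr_gt0.
move=> m mL; rewrite -(lebint_prod (f := f))//; apply: le_lebint.
- apply/measurable_EFinP; apply: measurable_prod => i _.
  by apply: (measurableT_comp (mf i)); exact: measurable_coor.
- by apply: measurable_restr; [exact: measurable_shell|exact: measurable_gauss_pdf].
- by move=> v; rewrite lee_fin; apply: prodr_ge0.
move=> v; have [/forallP vI|/forallPn[i vI]] := boolP [forall i, a < v i ord0 <= b]; last first.
  rewrite (bigD1 i)//= {1}/f indicE memNset ?mulr0 ?mul0r; last first.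
    by rewrite /I/= in_itv/=; exact/negP.
  by case: ifP => // _; rewrite lee_fin gauss_pdf_ge0.
have vi i : a ^+ 2 < v i ord0 ^+ 2 <= b ^+ 2.
  by have /andP[? ?] := vI i; apply/andP; split; nra.
have -> : M1 < sqnorm v <= M2.
  have sumc (c : R) : \sum_(i < n.+1) c = c * n.+1%:R.
    by rewrite sumr_const card_ord mulr_natr.
  rewrite -a2 -b2 -!sumc /sqnorm; apply/andP; split.
    (* The strict inequality is drawn from the first coordinate, which exists in dimension
       [n.+1]. *)
    rewrite !big_ord_recl; apply: ltr_leD; first by have /andP[] := vi ord0.
    by apply: ler_sum => i _; have /andP[/ltW] := vi (lift ord0 i).
  by apply: ler_sum => i _; have /andP[] := vi i.
rewrite lee_fin gauss_pdf_prod; apply: ler_prod => i _; rewrite f0/=.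
rewrite /f indicE mem_set ?mulr1; last by rewrite /I/= in_itv/=.
rewrite normal_pdfE ?oner_neq0//= /k ler_wpM2l ?normal_peak_ge0//.
rewrite /normal_fun ler_expR expr1n mulNr mulNr lerN2 ler_pM2r ?invr_gt0 ?ltr0n//.
have := ler_sqrt_sqnorm i mL; rewrite ler_norml => /andP[? ?].
have sL := sqrtr_ge0 L; have /andP[? ?] := vI i.
have : - (b + Num.sqrt L) <= v i ord0 - m i ord0 <= b + Num.sqrt L.
  by apply/andP; split; lra.
by move=> /andP[? ?]; rewrite -subr_ge0 subr_sqr mulr_ge0//; lra.
Qed.

(** Continuity from below along the intervals [[-k, k]] supplies the radius; translation makes the
    mass [p] the same for every mean. *)
Lemma normal_central_mass (eps : R) : 0 < eps -> exists r p : R,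
  [/\ 0 <= r, 0 <= p <= 1, 1 - eps <= p & forall m : R,
   (\int[mu]_x (if (`|x - m| <= r)%R then (normal_pdf m 1 x)%:E else 0) = p%:E)%E].
Proof.
move=> eps0.
pose F (k : nat) : set R := `[- k%:R, k%:R]%classic.
have mF k : measurable (F k) by exact: measurable_itv.
have [k kP] : exists k : nat, ((1 - eps)%:E <= normal_prob 0 1 (F k))%E.
  apply/not_existsP => H.
  have bigF : \bigcup_k F k = setT.
    apply/seteqP; split => // x _; exists (Num.bound `|x|) => //=.
    rewrite /F/= in_itv/= -ler_norml; exact/ltW/archi_boundP.
  have cF : normal_prob 0 1 (F i) @[i --> \oo] --> normal_prob 0 1 (\bigcup_k F k).
    apply: nondecreasing_cvg_mu => //; first by rewrite bigF; exact: measurableT.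
    move=> i j ij; apply/subsetPset => x; rewrite /F/= !in_itv/= => /andP[? ?].
    have : (i%:R : R) <= j%:R by rewrite ler_nat.
    by move=> ?; apply/andP; split; lra.
  rewrite bigF [normal_prob 0 1 setT]probability_setT in cF.
  have : (1 <= (1 - eps)%:E :> \bar R)%E.
    rewrite -(cvg_lim _ cF)//; apply: lime_le; first by apply/cvg_ex; exists 1%E.
    by near=> i; have /negP := H i; rewrite -ltNge => /ltW.
  by rewrite lee_fin; lra.
pose p := fine (normal_prob 0 1 (F k)).
have pfin : normal_prob 0 1 (F k) = p%:E.
  by rewrite /p fineK// ; exact: (fin_num_measure (normal_prob 0 1) _ (mF k)).
exists k%:R, p; split => //.
- apply/andP; split; rewrite -lee_fin -pfin.
    exact: measure_ge0.
  exact: (@probability_le1 _ _ _ (normal_prob 0 1) _ (mF k)).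
- by rewrite -lee_fin -pfin.
move=> m; rewrite (@integral_affine R 1 m) ?oner_neq0//; last 2 first.
- apply: measurable_restr; last exact: measurable_normal_pdf.
  apply: measurable_fun_ler => //; apply: measurableT_comp => //.
  exact: measurable_funB.
- by move=> x; case: ifP => // _; rewrite lee_fin normal_pdf_ge0.
rewrite normr1 mul1e -pfin /normal_prob [RHS]integral_mkcond; apply: eq_integral => x _.
rewrite /patch mul1r addrK mem_setE/= in_itv/= -ler_norml; case: ifP => // _.
by rewrite !normal_pdfE ?oner_neq0//= /normal_fun addrK subr0.
Unshelve. all: by end_near.
Qed.

(** Bernoulli's inequality: if each coordinate loses at most [eps / n] of its mass, the product of
    [n] of them loses at most [eps]. *)
Lemma bernoulli_le (p e : R) n : 0 <= p <= 1 -> 1 - e <= p -> 1 - e *+ n <= p ^+ n.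
Proof.
move=> /andP[p0 p1] ep; elim: n => [|n IH]; first by rewrite mulr0n subr0 expr0.
rewrite exprS; apply: le_trans (ler_wpM2l p0 IH); rewrite mulrS -[e *+ n]mulr_natl.
have : 0 <= (1 - p) * (n%:R * e) by rewrite !mulr_ge0//; lra.
by lra.
Qed.

Lemma ball_prob_to1 n (L eps : R) : 0 <= L -> 0 < eps ->
  exists2 M : R, 0 <= M & forall m : 'cV[R]_n.+1, sqnorm m <= L ->
    ((1 - eps)%:E <= ball_prob M m)%E.
Proof.
move=> L0 eps0; have N0 : 0 < n.+1%:R :> R by rewrite ltr0n.
have [r [p [r0 p01 pe pI]]] := normal_central_mass (divr_gt0 eps0 N0).
(* This ball contains the cube of half-side [r] around the mean, because x^2 <= 2 (x - m)^2 + 2 m^2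
   in each coordinate. *)
exists ((r ^+ 2 *+ n.+1 + L) * 2).
  by rewrite mulr_ge0// addr_ge0// mulrn_wge0// sqr_ge0.
move=> m mL.
pose f i (x : R) : R := if `|x - m i ord0| <= r then normal_pdf (m i ord0) 1 x else 0.
have fE i x : (f i x)%:E = if `|x - m i ord0| <= r then (normal_pdf (m i ord0) 1 x)%:E else 0%E.
  by rewrite /f; case: ifP.
have f0 i x : 0 <= f i x by rewrite /f; case: ifP => // _; exact: normal_pdf_ge0.
have mf i : measurable_fun setT (f i).
  apply: measurable_fun_ifT => //; last exact: measurable_normal_pdf.
  apply: measurable_fun_ler => //; apply: measurableT_comp => //.
  exact: measurable_funB.
apply: (@le_trans _ _ (lebint (fun v : 'cV[R]_n.+1 => (\prod_i f i (v i ord0))%:E))).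
  rewrite (lebint_prod (c := fun=> p))//; last first.
    by move=> i; under eq_integral do rewrite fE; exact: pI.
  rewrite prodr_const card_ord lee_fin (le_trans _ (bernoulli_le n.+1 p01 pe))//.
  by rewrite -[_ / _ *+ _]mulr_natr divfK ?gt_eqF.
apply: le_lebint.
- apply/measurable_EFinP; apply: measurable_prod => i _.
  by apply: (measurableT_comp (mf i)); exact: measurable_coor.
- apply: measurable_restr; last exact: measurable_gauss_pdf.
  by apply: measurable_fun_ler => //; exact: measurable_sqnorm.
- by move=> v; rewrite lee_fin; apply: prodr_ge0.
move=> v; have [/forallP vI|/forallPn[i /negbTE vI]] :=
    boolP [forall i, `|v i ord0 - m i ord0| <= r]; last first.
  rewrite (bigD1 i)//= {1}/f vI mul0r.
  by case: ifP => // _; rewrite lee_fin gauss_pdf_ge0.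
have -> : sqnorm v <= (r ^+ 2 *+ n.+1 + L) * 2.
  rewrite (@le_trans _ _ (\sum_i (r ^+ 2 + m i ord0 ^+ 2) * 2))//.
    apply: ler_sum => i _; have := vI i; rewrite ler_norml => /andP[? ?].
    have : (v i ord0 - m i ord0) ^+ 2 <= r ^+ 2.
      by rewrite -subr_ge0 subr_sqr mulr_ge0//; lra.
    have := sqr_ge0 (v i ord0 - 2 * m i ord0); nra.
  by rewrite -mulr_suml big_split/= sumr_const card_ord ler_wpM2r// lerD2l.
rewrite lee_fin gauss_pdf_prod; apply: ler_prod => i _.
by rewrite f0/= /f vI.
Qed.

End ball_prob_limits.

(** * The pretest estimator *)

Section pretest_algebra.
Context {R : realType} (n : nat).
Variables S0 S1 : 'M[R]_n.+1.
Hypotheses (pS0 : posdef S0) (pS1 : posdef S1).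
Local Notation T := (S0 + S1).
Local Notation H := (invmx S0 + invmx S1).

Let pT : posdef T. Proof. exact: posdefD. Qed.
Let pH : posdef H. Proof. by apply: posdefD; exact: posdef_inv. Qed.
Let S0u := posdef_unit pS0.
Let S1u := posdef_unit pS1.

Lemma sqrtm_sym (A : 'M[R]_n.+1) : posdef A -> (sqrtm A)^T = sqrtm A.
Proof. by move=> /(sqrtmP (ltn0Sn n))[]. Qed.

Lemma sqrtm_mul (A : 'M[R]_n.+1) : posdef A -> sqrtm A *m sqrtm A = A.
Proof. by move=> /(sqrtmP (ltn0Sn n))[_ []]. Qed.

Lemma sqrtm_unit (A : 'M[R]_n.+1) : posdef A -> sqrtm A \in unitmx.
Proof.
move=> pA; have := posdef_unit pA; rewrite -{1}(sqrtm_mul pA).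
by rewrite unitmx_mul => /andP[].
Qed.

Lemma det_posdef_gt0 (A : 'M[R]_n.+1) : posdef A -> 0 < \det A.
Proof.
move=> pA; rewrite lt0r -unitfE -unitmxE posdef_unit//=.
by rewrite -(sqrtm_mul pA) det_mulmx -expr2 sqr_ge0.
Qed.

Lemma norm_det_sqrtm (A : 'M[R]_n.+1) : posdef A -> `|\det (sqrtm A)| = Num.sqrt (\det A).
Proof. by move=> pA; rewrite -{2}(sqrtm_mul pA) det_mulmx -expr2 sqrtr_sqr. Qed.

Lemma quadform_sqrtm (A : 'M[R]_n.+1) v : posdef A -> quadform A v = sqnorm (sqrtm A *m v).
Proof. by move=> pA; rewrite -{1}(sqrtm_mul pA) quadformE// sqrtm_sym. Qed.

Lemma quadform_invmx_sqrtm (A : 'M[R]_n.+1) v : posdef A ->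
  quadform (invmx A) v = sqnorm (invsqrtm A *m v).
Proof.
move=> pA; have su := sqrtm_unit pA.
rewrite /invsqrtm -quadformE; last by rewrite trmx_inv sqrtm_sym.
by rewrite -{1}(sqrtm_mul pA) -[sqrtm A *m _]/(sqrtm A * sqrtm A) -[invmx _]/(_^-1) invrM.
Qed.

Lemma quadform_addE (P : 'M[R]_n.+1) x y : P^T = P ->
  quadform P (x + y) = quadform P x + 2 * (x^T *m P *m y) ord0 ord0 + quadform P y.
Proof.
move=> PT; have xyT : (x + y)^T = x^T + y^T by exact: raddfD.
have addE (A B : 'M[R]_1) : (A + B) ord0 ord0 = A ord0 ord0 + B ord0 ord0 by rewrite mxE.
rewrite /quadform xyT !mulmxDl !mulmxDr !addE.
have -> : y^T *m P *m x = (x^T *m P *m y)^T by rewrite !trmx_mul trmxK PT mulmxA.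
by rewrite [_^T _ _]mxE; ring.
Qed.

(** Gives both the inverse of [H] needed in [woodbury] and the determinant identity needed for the
    density constants. *)
Lemma precision_sumE : H = invmx S0 *m T *m invmx S1.
Proof. by rewrite mulmxDr mulVmx// mulmxDl mul1mx mulmxK// addrC. Qed.

(** With H^-1 = S1 T^-1 S0 the right side becomes T^-1 (S0 + S1) S1^-1. *)
Lemma woodbury : invmx S1 = invmx S1 *m invmx H *m invmx S1 + invmx T.
Proof.
have Tu := posdef_unit pT; have Hu := posdef_unit pH.
have -> : invmx H = S1 *m invmx T *m S0.
  apply: (can_inj (mulKmx Hu)); rewrite mulmxV// precision_sumE !mulmxA.
  by rewrite mulmxKV// mulmxK// mulVmx.
rewrite !mulmxA mulVmx// mul1mx -[X in _ + X](mulmxK S1u) -mulmxDl -mulmxDr.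
by rewrite mulVmx// mul1mx.
Qed.

(** Completing the square in [a]: the cross terms agree because H times the weight is S1^-1, and the
    term left in [c] alone is [woodbury]. *)
Lemma quadform_complete (a c : 'cV[R]_n.+1) :
  quadform (invmx S0) a + quadform (invmx S1) (a + c) =
  quadform H (a + invmx H *m invmx S1 *m c) + quadform (invmx T) c.
Proof.
have Hu := posdef_unit pH; have [HT _] := pH.
have i1T : (invmx S1)^T = invmx S1 by rewrite trmx_inv; case: pS1 => ->.
rewrite !quadform_addE//; set W := invmx H *m invmx S1.
have HW : H *m W = invmx S1 by rewrite mulmxA mulmxV// mul1mx.
have -> : a^T *m H *m (W *m c) = a^T *m invmx S1 *m c.
  by rewrite mulmxA -[a^T *m H *m W]mulmxA HW.
have addE (A B : 'M[R]_1) : (A + B) ord0 ord0 = A ord0 ord0 + B ord0 ord0 by rewrite mxE.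
have -> : quadform (invmx S1) c = quadform H (W *m c) + quadform (invmx T) c.
  have WT : W^T = invmx S1 *m invmx H by rewrite trmx_mul i1T trmx_inv HT.
  rewrite /quadform trmx_mul WT mulmxA -[_ *m H *m W]mulmxA HW.
  by rewrite [in LHS]woodbury mulmxDr mulmxDl addE !mulmxA.
have -> : quadform H a = quadform (invmx S0) a + quadform (invmx S1) a.
  by rewrite /quadform mulmxDr mulmxDl addE.
by ring.
Qed.

End pretest_algebra.

(** * The joint density in decorrelated coordinates *)

Section pretest_density.
Context {R : realType} (n : nat).
Variables S0 S1 : 'M[R]_n.+1.
Hypotheses (pS0 : posdef S0) (pS1 : posdef S1).
Local Notation T := (S0 + S1).
Local Notation H := (invmx S0 + invmx S1).
Local Notation rT := (sqrtm T).
Local Notation rH := (sqrtm H).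
Local Notation W := (invmx H *m invmx S1).

Let pT : posdef T. Proof. exact: posdefD. Qed.
Let pH : posdef H. Proof. by apply: posdefD; exact: posdef_inv. Qed.

(** Turns the weight used by the estimator into the matrix of the noncentrality parameters. *)
Lemma sqrtm_precision_weight : rH *m W = invsqrtm H *m invmx S1.
Proof.
have rHu := sqrtm_unit pH.
rewrite mulmxA; congr (_ *m _).
have e : invmx rH *m H = rH by rewrite -[X in _ *m X](sqrtm_mul pH) mulKmx.
by rewrite -{1}e mulmxK// posdef_unit.
Qed.

Lemma gauss_pdf_exp m (S : 'M[R]_n.+1) (v : 'cV[R]_n.+1) : posdef S ->
  gauss_pdf m S v = Num.sqrt (pi *+ 2) ^- n.+1 * (Num.sqrt (\det S))^-1 *
    expR (- quadform (invmx S) (v - m) / 2).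
Proof.
move=> pS; have p0 : 0 <= pi *+ 2 :> R by rewrite mulrn_wge0// pi_ge0.
rewrite /gauss_pdf sqrtrM ?exprn_ge0// invfM; congr (_^-1 * _ * _).
by elim: n.+1 => [|k IH]; rewrite ?sqrtr1// !exprS sqrtrM ?IH.
Qed.

(** Here [a] is the error of the first observation and [rT *m u] the difference of the two; the
    determinants are the Jacobians of the substitutions in [prob_PT_lebint]. Exponents match by
    [quadform_complete], constants by det T = det S0 det H det S1. *)
Lemma gauss_pdf_change (tau D a u : 'cV[R]_n.+1) :
  gauss_pdf tau S0 (tau + a) * gauss_pdf (tau + D) S1 (tau + a + rT *m u) *
    (`|\det rT| * `|\det (invmx rH)|) =
  gauss_pdf (invsqrtm H *m invmx S1 *m D) 1%:M (rH *m (a + W *m (rT *m u))) *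
    gauss_pdf (invsqrtm T *m D) 1%:M u.
Proof.
have rTu := sqrtm_unit pT.
rewrite (gauss_pdf_exp _ _ pS0) (gauss_pdf_exp _ _ pS1) !gauss_pdf_sqnorm.
have -> : tau + a - tau = a by rewrite addrAC subrr add0r.
pose c := rT *m u - D.
have -> : tau + a + rT *m u - (tau + D) = a + c.
  by rewrite /c; apply/matrixP => i j; rewrite !mxE; ring.
have -> : u - invsqrtm T *m D = invsqrtm T *m c by rewrite /c mulmxBr mulKmx.
have -> : rH *m (a + W *m (rT *m u)) - invsqrtm H *m invmx S1 *m D = rH *m (a + W *m c).
  by rewrite -sqrtm_precision_weight /c mulmxBr [in RHS]mulmxDr mulmxBr [in LHS]mulmxDr !mulmxA addrA.
rewrite -quadform_sqrtm// -quadform_invmx_sqrtm//.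
have := quadform_complete pS0 pS1 a c.
move: (quadform (invmx S0) a) (quadform (invmx S1) (a + c)) (quadform H _)
  (quadform (invmx T) c) => x y w z xyzw.
have eE : expR (- x / 2) * expR (- y / 2) = expR (- w / 2) * expR (- z / 2).
  by rewrite -!expRD; congr expR; lra.
rewrite det_inv normfV !norm_det_sqrtm//.
have dT : \det T = \det S0 * \det H * \det S1.
  rewrite (precision_sumE pS0 pS1) !det_mulmx !det_inv.
  have := det_posdef_gt0 pS0; have := det_posdef_gt0 pS1 => ? ?; field.
  by rewrite !gt_eqF.
have d0 := det_posdef_gt0 pS0; have d1 := det_posdef_gt0 pS1; have dH := det_posdef_gt0 pH.
rewrite dT !sqrtrM ?mulr_ge0// ?ltW//.
have sd0 : Num.sqrt (\det S0) != 0 by rewrite sqrtr_eq0 -ltNge.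
have sd1 : Num.sqrt (\det S1) != 0 by rewrite sqrtr_eq0 -ltNge.
have sdH : Num.sqrt (\det H) != 0 by rewrite sqrtr_eq0 -ltNge.
move: (Num.sqrt (\det S0)) (Num.sqrt (\det S1)) (Num.sqrt (\det H)) sd0 sd1 sdH => s0 s1 sH s00 s10 sH0.
move: (_ ^- n.+1) => k.
transitivity (k * k * (expR (- x / 2) * expR (- y / 2))).
  by field; rewrite ?s00 ?s10 ?sH0.
by rewrite eE; ring.
Qed.

End pretest_density.

(** * The coverage probability as one Gaussian integral *)

Section pretest_integral.
Context {R : realType} (n : nat).
Variables S0 S1 : 'M[R]_n.+1.
Hypotheses (pS0 : posdef S0) (pS1 : posdef S1).
Local Notation T := (S0 + S1).
Local Notation H := (invmx S0 + invmx S1).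
Local Notation rT := (sqrtm T).
Local Notation rH := (sqrtm H).
Local Notation W := (invmx H *m invmx S1).

Let pT : posdef T. Proof. exact: posdefD. Qed.
Let pH : posdef H. Proof. by apply: posdefD; exact: posdef_inv. Qed.

(* The mean of H^(1/2) (tauPT - tau) given u = T^(-1/2) (tau1hat - tau0hat). *)
Definition pt_mean (q : R) (D u : 'cV[R]_n.+1) : 'cV[R]_n.+1 :=
  if sqnorm u <= q then invsqrtm H *m invmx S1 *m D
  else invsqrtm H *m invmx S1 *m (D - rT *m u).

Definition pt_shift (q : R) (u : 'cV[R]_n.+1) : 'cV[R]_n.+1 :=
  if sqnorm u <= q then W *m (rT *m u) else 0.

Lemma measurable_pt_mean q D : measurable_fun setT (pt_mean q D).
Proof.
apply: measurable_fun_ifT => //.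
  by apply: measurable_fun_ler => //; exact: measurable_sqnorm.
by apply: measurable_mulmx; apply: measurable_addmx => //;
  apply: measurable_oppmx; exact: measurable_mulmx.
Qed.

Lemma tau_PT_shift q (x0 u : 'cV[R]_n.+1) :
  tau_PT S0 S1 q x0 (rT *m u + x0) = x0 + pt_shift q u.
Proof.
by rewrite /tau_PT /pt_shift addrK /invsqrtm mulKmx// sqrtm_unit.
Qed.

Lemma gauss_pdf_translate k (m v e : 'cV[R]_k) :
  gauss_pdf m 1%:M (v + e) = gauss_pdf (m - e) 1%:M v.
Proof. by rewrite !gauss_pdf_sqnorm opprB addrA. Qed.

(** Substitute [x1 = rT *m u + x0], exchange the integrals, then for fixed [u] let [v] be [rH] times
    the error of the estimator. The loss is [sqnorm v] in both branches, and the pretest only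
    affects the mean [pt_mean q D u]. *)
Lemma prob_PT_lebint q (tau D : 'cV[R]_n.+1) M :
  lebint (fun x0 : 'cV[R]_n.+1 => lebint (fun x1 : 'cV[R]_n.+1 =>
    if quadform H (tau_PT S0 S1 q x0 x1 - tau) <= M
    then (gauss_pdf tau S0 x0 * gauss_pdf (tau + D) S1 x1)%:E else 0%E)) =
  lebint (fun u => (gauss_pdf (invsqrtm T *m D) 1%:M u)%:E *
    ball_prob M (pt_mean q D u))%E.
Proof.
have rTu := sqrtm_unit pT; have rHu := sqrtm_unit pH.
pose F (x0 x1 : 'cV[R]_n.+1) : \bar R :=
  if quadform H (tau_PT S0 S1 q x0 x1 - tau) <= M
  then (gauss_pdf tau S0 x0 * gauss_pdf (tau + D) S1 x1)%:E else 0%E.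
have F0 x0 x1 : (0 <= F x0 x1)%E.
  by rewrite /F; case: ifP => // _; rewrite lee_fin mulr_ge0// gauss_pdf_ge0.
have mF : measurable_fun [set: 'cV[R]_n.+1 * 'cV[R]_n.+1] (fun p => F p.1 p.2).
  apply: measurable_restr; last first.
    by apply: measurable_funM; apply: measurable_gauss_pdf.
  apply: measurable_fun_ler => //; apply: measurable_quadform.
  apply: measurable_addmx => //; apply: measurable_addmx => //.
  have mB : measurable_fun [set: 'cV[R]_n.+1 * 'cV[R]_n.+1] (fun p => p.2 - p.1).
    by apply: measurable_addmx => //; exact: measurable_oppmx.
  apply: measurable_fun_ifT => //; last exact: measurable_mulmx.
  by apply: measurable_fun_ler => //; apply: measurable_sqnorm; exact: measurable_mulmx.
have mFx x : measurable_fun setT (F x) by exact: (measurable_fun_pair2 x mF).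
pose G (x0 u : 'cV[R]_n.+1) := F x0 (rT *m u + x0).
have mG : measurable_fun [set: 'cV[R]_n.+1 * 'cV[R]_n.+1] (fun p => G p.1 p.2).
  apply: (measurable_comp2 mF) => //; apply: measurable_addmx => //.
  exact: measurable_mulmx.
have step1 x0 : lebint (F x0) = (`|\det rT|%:E * lebint (G x0))%E.
  have mFs : measurable_fun setT (fun v : 'cV[R]_n.+1 => F x0 (v + x0)).
    by apply: (measurableT_comp (mFx x0)); exact: measurable_addmx.
  rewrite (lebint_shift x0 (mFx x0) (F0 x0)).
  rewrite (lebint_linear_change rTu mFs (fun v => F0 x0 (v + x0))).
  reflexivity.
have G0 x0 u : (0 <= G x0 u)%E by exact: F0.
have dT0 : (0 <= `|\det rT|%:E)%E by rewrite lee_fin.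
have mG1 : measurable_fun setT (fun u : 'cV[R]_n.+1 => lebint (G ^~ u)).
  apply: (@measurable_lebint _ _ _ _ (fun v u => G u v)); last by move=> t v; exact: G0.
  by apply: (measurable_comp2 mG); [exact: measurable_snd|exact: measurable_fst].
rewrite (eq_lebint step1).
rewrite (lebintZl (measurable_lebint mG G0) (fun x => lebint_ge0 (G0 x)) dT0).
rewrite (lebint_swap mG G0) -(lebintZl mG1 (fun u => lebint_ge0 (G0 ^~ u)) dT0).
apply: eq_lebint => u.
pose c := tau - pt_shift q u.
have mGu : measurable_fun setT (G ^~ u) by exact: (measurable_fun_pair1 u mG).
have mGs : measurable_fun setT (fun v : 'cV[R]_n.+1 => G (v + c) u).
  by apply: (measurableT_comp mGu); exact: measurable_addmx.
have mGc : measurable_fun setT (fun v : 'cV[R]_n.+1 => G (invmx rH *m v + c) u).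
  by apply: (measurableT_comp mGs); exact: measurable_mulmx.
have rHVu : invmx rH \in unitmx by rewrite unitmx_inv.
rewrite (lebint_shift c mGu (G0 ^~ u)).
rewrite (lebint_linear_change rHVu mGs (fun v => G0 (v + c) u)).
rewrite muleA -EFinM -(lebintZl mGc (fun v => G0 (invmx rH *m v + c) u)); last first.
  by rewrite lee_fin mulr_ge0.
rewrite /ball_prob -lebintZl//; last 3 first.
- apply: measurable_restr; last exact: measurable_gauss_pdf.
  by apply: measurable_fun_ler => //; exact: measurable_sqnorm.
- by move=> v; case: ifP => // _; rewrite lee_fin gauss_pdf_ge0.
- by rewrite lee_fin gauss_pdf_ge0.
apply: eq_lebint => v.
rewrite /G /F tau_PT_shift.
have -> : invmx rH *m v + c + pt_shift q u - tau = invmx rH *m v.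
  by rewrite /c; apply/matrixP => i j; rewrite !mxE; ring.
rewrite quadform_sqrtm// mulKVmx//; case: ifP => _; last by rewrite !mule0.
rewrite -!EFinM mulrC; congr (_%:E).
pose a := invmx rH *m v - pt_shift q u.
have -> : invmx rH *m v + c = tau + a by rewrite /c /a addrCA.
rewrite [rT *m u + _]addrC (gauss_pdf_change pS0 pS1 tau D a u) mulrC.
(* The argument of the density differs from [v] by a vector depending on [u] alone, which is moved
   into the mean. *)
have -> : rH *m (a + W *m (rT *m u)) = v + rH *m (W *m (rT *m u) - pt_shift q u).
  by rewrite /a addrAC -addrA mulmxDr mulKVmx.
rewrite gauss_pdf_translate.
rewrite (_ : invsqrtm H *m invmx S1 *m D - rH *m (W *m (rT *m u) - pt_shift q u) = pt_mean q D u)//.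
rewrite /pt_shift /pt_mean; case: ifP => _; first by rewrite subrr mulmx0 subr0.
by rewrite subr0 mulmxA (sqrtm_precision_weight pS0 pS1) -mulmxBr.
Qed.

(** The integral is at most the Gaussian mass 1, so the [fine] in [prob_PT] loses nothing. *)
Lemma prob_PT_fin q (tau D : 'cV[R]_n.+1) M :
  (prob_PT S0 S1 q tau D M)%:E =
  lebint (fun u => (gauss_pdf (invsqrtm T *m D) 1%:M u)%:E *
    ball_prob M (pt_mean q D u))%E.
Proof.
rewrite /prob_PT prob_PT_lebint fineK//.
rewrite ge0_fin_numE; last first.
  by apply: lebint_ge0 => u; rewrite mule_ge0 ?ball_prob_ge0// lee_fin gauss_pdf_ge0.
apply: (@le_lt_trans _ _ 1%E); last exact: ltry.
rewrite -(lebint_gauss (invsqrtm T *m D)); apply: le_lebint.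
- apply: emeasurable_funM; last by apply: measurable_ball_prob; exact: measurable_pt_mean.
  by apply/measurable_EFinP; exact: measurable_gauss_pdf.
- by apply/measurable_EFinP; exact: measurable_gauss_pdf.
- by move=> u; rewrite mule_ge0 ?ball_prob_ge0// lee_fin gauss_pdf_ge0.
- move=> u; rewrite -[leRHS]mule1; apply: lee_wpmul2l; last exact: ball_prob_le1.
  by rewrite lee_fin gauss_pdf_ge0.
Qed.

End pretest_integral.

(** * Decomposition and uniform bounds for the coverage probability *)

Section pretest_bounds.
Context {R : realType} (n : nat).
Variables S0 S1 : 'M[R]_n.+1.
Hypotheses (pS0 : posdef S0) (pS1 : posdef S1).
Local Notation T := (S0 + S1).
Local Notation H := (invmx S0 + invmx S1).
Local Notation rT := (sqrtm T).
Local Notation prob := (prob_PT S0 S1).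
Local Opaque prob_PT gauss_pdf.

Lemma ncchi2_cdf_mull M (m : 'cV[R]_n.+1) (c : R) :
  (ncchi2_cdf n.+1 M (sqnorm m) * c)%:E = (ball_prob M m * c%:E)%E.
Proof. by rewrite EFinM ncchi2_cdfE. Qed.

(** Where the pretest accepts, [pt_mean] is constant in [u], so the ball probability factors out and
    leaves the Gaussian mass of the acceptance region. *)
Lemma prob_PT_split q (tau D : 'cV[R]_n.+1) M :
  (prob q tau D M)%:E =
  ((ncchi2_cdf n.+1 M (sqnorm (invsqrtm H *m invmx S1 *m D)) *
    ncchi2_cdf n.+1 q (sqnorm (invsqrtm T *m D)))%:E +
   lebint (fun u : 'cV[R]_n.+1 => if (q < sqnorm u)%R then
     (ncchi2_cdf n.+1 M (sqnorm (invsqrtm H *m invmx S1 *m (D - rT *m u))) *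
      gauss_pdf (invsqrtm T *m D) 1%:M u)%R%:E else 0%E))%E.
Proof.
apply: (etrans (prob_PT_fin pS0 pS1 q tau D M)).
pose g u := gauss_pdf (invsqrtm T *m D) 1%:M u.
have g0 u : (0 <= (g u)%:E)%E by rewrite lee_fin gauss_pdf_ge0.
have mg : measurable_fun setT (fun u : 'cV[R]_n.+1 => (g u)%:E).
  by apply/measurable_EFinP; exact: measurable_gauss_pdf.
pose m0 := invsqrtm H *m invmx S1 *m D.
pose m1 u := invsqrtm H *m invmx S1 *m (D - rT *m u).
pose b (u : 'cV[R]_n.+1) := if sqnorm u <= q then (g u)%:E else 0%E.
pose r (u : 'cV[R]_n.+1) := if q < sqnorm u then (ball_prob M (m1 u) * (g u)%:E)%E else 0%E.
have mb : measurable_fun setT b.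
  apply: measurable_restr; last exact: measurable_gauss_pdf.
  by apply: measurable_fun_ler => //; exact: measurable_sqnorm.
have b0 u : (0 <= b u)%E by rewrite /b; case: ifP.
have mr : measurable_fun setT r.
  apply: measurable_fun_ifT => //.
    by apply: measurable_fun_ltr => //; exact: measurable_sqnorm.
  apply: emeasurable_funM => //.
  apply: measurable_ball_prob; apply: measurable_mulmx; apply: measurable_addmx => //.
  by apply: measurable_oppmx; exact: measurable_mulmx.
have r0 u : (0 <= r u)%E.
  by rewrite /r; case: ifP => // _; rewrite mule_ge0// ball_prob_ge0.
have mcb : measurable_fun setT (fun u => ball_prob M m0 * b u)%E.
  by apply: emeasurable_funM => //; exact: measurable_cst.
transitivity (ball_prob M m0 * lebint b + lebint r)%E.
  rewrite -(lebintZl mb b0 (ball_prob_ge0 M m0)) -(lebintD mcb mr)//.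
    apply: eq_lebint => u; rewrite /b /r /pt_mean -/m0 -/(m1 u) -/(g u).
    by case: leP => _; move: (ball_prob M m0) (ball_prob M _) ((g u)%:E) => x y z;
      rewrite ?mule0 ?add0e ?adde0 muleC.
  by move=> u; rewrite mule_ge0// ball_prob_ge0.
have bE : lebint b = (ncchi2_cdf n.+1 q (sqnorm (invsqrtm T *m D)))%:E.
  exact: (esym (ncchi2_cdfE q (invsqrtm T *m D))).
rewrite bE; apply: (congr2 (fun x y => x + y)%E).
  exact: (esym (ncchi2_cdf_mull M m0 _)).
apply: eq_lebint => u; rewrite /r; case: ifP => _; last by [].
exact: (esym (ncchi2_cdf_mull M (m1 u) (g u))).
Qed.

Lemma measurable_shell_prob d (X : measurableType d) k M1 M2 (f : X -> 'cV[R]_k) :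
  measurable_fun [set: X] f -> measurable_fun [set: X] (fun t => shell_prob M1 M2 (f t)).
Proof.
move=> mf; apply: (@measurable_lebint _ _ _ _ (fun t v =>
  if M1 < sqnorm v <= M2 then (gauss_pdf (f t) 1%:M v)%:E else 0%E)).
  apply: measurable_restr; first by apply: measurable_shell; exact: measurable_snd.
  by apply: measurable_gauss_pdf => //; exact: (measurableT_comp mf).
by move=> t v; case: ifP => // _; rewrite lee_fin gauss_pdf_ge0.
Qed.

Let pdf0 (D u : 'cV[R]_n.+1) : (0 <= (gauss_pdf (invsqrtm T *m D) 1%:M u)%:E)%E.
Proof. by rewrite lee_fin gauss_pdf_ge0. Qed.

Let mpdf (D : 'cV[R]_n.+1) :
  measurable_fun setT (fun u : 'cV[R]_n.+1 => (gauss_pdf (invsqrtm T *m D) 1%:M u)%:E).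
Proof. by apply/measurable_EFinP; exact: measurable_gauss_pdf. Qed.

Let mball q (D : 'cV[R]_n.+1) M : measurable_fun setT (fun u : 'cV[R]_n.+1 =>
  (gauss_pdf (invsqrtm T *m D) 1%:M u)%:E * ball_prob M (pt_mean S0 S1 q D u))%E.
Proof.
apply: emeasurable_funM; first exact: mpdf.
by apply: measurable_ball_prob; exact: measurable_pt_mean.
Qed.

Let mshell q (D : 'cV[R]_n.+1) M1 M2 : measurable_fun setT (fun u : 'cV[R]_n.+1 =>
  (gauss_pdf (invsqrtm T *m D) 1%:M u)%:E * shell_prob M1 M2 (pt_mean S0 S1 q D u))%E.
Proof.
apply: emeasurable_funM; first exact: mpdf.
by apply: measurable_shell_prob; exact: measurable_pt_mean.
Qed.

Lemma prob_PT_shell q (tau D : 'cV[R]_n.+1) M1 M2 : M1 <= M2 ->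
  (prob q tau D M2)%:E = ((prob q tau D M1)%:E +
    lebint (fun u => (gauss_pdf (invsqrtm T *m D) 1%:M u)%:E *
      shell_prob M1 M2 (pt_mean S0 S1 q D u)))%E.
Proof.
move=> M12; apply: (etrans (prob_PT_fin pS0 pS1 q tau D M2)); apply/esym.
apply: (etrans (congr1 (fun z => z + _)%E (prob_PT_fin pS0 pS1 q tau D M1))).
apply/esym; rewrite -(lebintD (mball q D M1) (mshell q D M1 M2)).
- apply: eq_lebint => u; rewrite (ball_prob_shell _ M12).
  by apply: ge0_muleDr; [exact: ball_prob_ge0|exact: shell_prob_ge0].
- by move=> u; apply: mule_ge0 => //; exact: ball_prob_ge0.
- by move=> u; apply: mule_ge0 => //; exact: shell_prob_ge0.
Qed.

Lemma prob_PT_ge0 q (tau D : 'cV[R]_n.+1) M : 0 <= prob q tau D M.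
Proof.
rewrite -lee_fin (prob_PT_fin pS0 pS1); apply: lebint_ge0 => u.
by rewrite mule_ge0// ball_prob_ge0.
Qed.

Lemma prob_PT_lt0 q (tau D : 'cV[R]_n.+1) M : M < 0 -> prob q tau D M = 0.
Proof.
move=> M0; apply: EFin_inj; rewrite (prob_PT_fin pS0 pS1).
have lebint_cst0 k : lebint (fun _ : 'cV[R]_k => 0%E) = 0%E :> \bar R.
  by elim: k => [|k IH]; rewrite ?lebint0// lebintS IH integral0.
rewrite -[RHS](lebint_cst0 n.+1); apply: eq_lebint => u.
rewrite (_ : ball_prob _ _ = 0%E) ?mule0// -[RHS](lebint_cst0 n.+1).
apply: eq_lebint => v; rewrite ifF//; apply/negbTE; rewrite -ltNge.
exact: lt_le_trans M0 (sqnorm_ge0 _).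
Qed.

(** The shell bound is uniform in the mean and survives averaging over [u]; being free of [D], it
    also survives the infimum. *)
Lemma prob_PT_le q (tau D : 'cV[R]_n.+1) M1 M2 : M1 <= M2 ->
  prob q tau D M2 <= prob q tau D M1 + 2 * Num.sqrt (M2 - M1).
Proof.
move=> M12.
have s0 : (0 <= (2 * Num.sqrt (M2 - M1))%:E)%E by rewrite lee_fin mulr_ge0// sqrtr_ge0.
suff h : (lebint (fun u => (gauss_pdf (invsqrtm T *m D) 1%:M u)%:E *
      shell_prob M1 M2 (pt_mean S0 S1 q D u))%E <= (2 * Num.sqrt (M2 - M1))%:E)%E.
  have := leeD2l (prob q tau D M1)%:E h.
  by rewrite -(prob_PT_shell q tau D M12) -EFinD lee_fin.
rewrite -[leRHS]mule1 -(lebint_gauss (invsqrtm T *m D)).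
rewrite -(lebintZl (mpdf D) (pdf0 D) s0).
apply: le_lebint; first exact: mshell.
- by apply: emeasurable_funM => //; exact: mpdf.
- by move=> u; apply: mule_ge0 => //; exact: shell_prob_ge0.
- by move=> u; rewrite muleC; apply: lee_wpmul2r => //; exact: shell_prob_le.
Qed.

(* Restricting u to a ball, where the conditional mean is bounded. *)
Let lebint_restr_ge (D : 'cV[R]_n.+1) (K c : R) (h : 'cV[R]_n.+1 -> \bar R) :
  0 <= c -> measurable_fun setT h -> (forall u, 0 <= h u)%E ->
  (forall u, sqnorm u <= K -> (c%:E <= h u)%E) ->
  (c%:E * ball_prob K (invsqrtm T *m D) <=
   lebint (fun u => (gauss_pdf (invsqrtm T *m D) 1%:M u)%:E * h u))%E.
Proof.
move=> c0 mh h0 hc.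
pose b (u : 'cV[R]_n.+1) := if sqnorm u <= K then (gauss_pdf (invsqrtm T *m D) 1%:M u)%:E else 0%E.
have mb : measurable_fun setT b.
  apply: measurable_restr; last exact: measurable_gauss_pdf.
  by apply: measurable_fun_ler => //; exact: measurable_sqnorm.
have b0 u : (0 <= b u)%E by rewrite /b; case: ifP.
have cE : (0 <= c%:E)%E by rewrite lee_fin.
rewrite -[ball_prob K _]/(lebint b) -(lebintZl mb b0 cE); apply: le_lebint.
- by apply: emeasurable_funM => //; exact: measurable_cst.
- by apply: emeasurable_funM => //; exact: mpdf.
- by move=> u; apply: mule_ge0.
- move=> u; rewrite /b; case: ifPn => uK; last by rewrite mule0; apply: mule_ge0.
  by rewrite muleC; apply: lee_wpmul2l => //; exact: hc.
Qed.

(** Each entry of [A *m v] is at most the l1 norm of a row of [A] times the norm of [v]. *)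
Lemma sqnorm_mulmx_le m k (A : 'M[R]_(m, k)) :
  exists2 C : R, 0 <= C & forall v, sqnorm (A *m v) <= C * sqnorm v.
Proof.
exists (\sum_i (\sum_j `|A i j|) ^+ 2).
  by apply: sumr_ge0 => i _; exact: sqr_ge0.
move=> v; rewrite mulr_suml; apply: ler_sum => i _.
rewrite -(sqr_sqrtr (sqnorm_ge0 v)) -exprMn -real_normK ?num_real//.
rewrite ler_pXn2r ?nnegrE ?mulr_ge0 ?sqrtr_ge0 ?sumr_ge0// mxE.
rewrite (le_trans (ler_norm_sum _ _ _))// mulr_suml; apply: ler_sum => j _.
by rewrite normrM ler_wpM2l//; exact: ler_sqrt_sqnorm.
Qed.

Lemma sqnormB_le k (x y : 'cV[R]_k) : sqnorm (x - y) <= 2 * sqnorm x + 2 * sqnorm y.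
Proof.
rewrite !mulr_sumr -big_split/=; apply: ler_sum => i _; rewrite !mxE.
have := sqr_ge0 (x i ord0 + y i ord0); nra.
Qed.

Lemma sqnorm_pt_mean_le q B K : 0 <= B -> 0 <= K ->
  exists2 L : R, 0 <= L & forall D u, sqnorm D <= B -> sqnorm u <= K ->
    sqnorm (pt_mean S0 S1 q D u) <= L.
Proof.
move=> B0 K0.
have [C C0 CP] := sqnorm_mulmx_le (invsqrtm H *m invmx S1).
have [C' C'0 C'P] := sqnorm_mulmx_le rT.
exists (C * (2 * B + 2 * (C' * K))); first by rewrite mulr_ge0// addr_ge0// !mulr_ge0.
move=> D u DB uK; rewrite /pt_mean; case: ifP => _; apply: (le_trans (CP _)).
  by rewrite ler_wpM2l//; have : 0 <= C' * K by [rewrite mulr_ge0]; lra.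
rewrite ler_wpM2l// (le_trans (sqnormB_le _ _))//.
have : C' * sqnorm u <= C' * K by rewrite ler_wpM2l.
by have := C'P u; lra.
Qed.

(** For [u] in the unit ball the conditional mean is bounded and the shell has mass at least [c];
    that ball itself has mass at least [c'], already from the shell between 0 and 1. *)
Lemma prob_PT_strict q B M1 M2 : 0 <= B -> 0 <= M1 -> M1 < M2 ->
  exists2 c : R, 0 < c & forall tau D : 'cV[R]_n.+1, sqnorm D <= B ->
    prob q tau D M1 + c <= prob q tau D M2.
Proof.
move=> B0 M10 M12.
have [L L0 LP] := sqnorm_pt_mean_le q B0 ler01.
have [C C0 CP] := sqnorm_mulmx_le (invsqrtm T).
have [c c0 cP] := shell_prob_ge n L M10 M12.
have [c' c'0 c'P] := shell_prob_ge n (C * B) (lexx 0) (@ltr01 R).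
exists (c * c'); first exact: mulr_gt0.
move=> tau D DB.
suff h : ((c * c')%:E <= lebint (fun u => (gauss_pdf (invsqrtm T *m D) 1%:M u)%:E *
    shell_prob M1 M2 (pt_mean S0 S1 q D u))%E)%E.
  have := leeD2l (prob q tau D M1)%:E h.
  by rewrite -(prob_PT_shell q tau D (ltW M12)) -EFinD lee_fin.
apply: (@le_trans _ _ (c%:E * ball_prob 1 (invsqrtm T *m D))%E).
  rewrite EFinM; apply: lee_wpmul2l; first by rewrite lee_fin ltW.
  rewrite (ball_prob_shell _ ler01); apply: (@le_trans _ _ (shell_prob 0 1 (invsqrtm T *m D))).
    by apply: c'P; rewrite (le_trans (CP _))// ler_wpM2l.
  by rewrite leeDr// ball_prob_ge0.
apply: lebint_restr_ge; first exact: ltW.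
- by apply: measurable_shell_prob; exact: measurable_pt_mean.
- by move=> u; exact: shell_prob_ge0.
- by move=> u u1; apply: cP; exact: LP.
Qed.

(** One factor [1 - eps] comes from confining [u] to a ball, the other from the conditional ball
    probability there. *)
Lemma prob_PT_to1 q B eps : 0 <= B -> 0 < eps <= 1 ->
  exists2 M : R, 0 <= M & forall tau D : 'cV[R]_n.+1, sqnorm D <= B ->
    (1 - eps) ^+ 2 <= prob q tau D M.
Proof.
move=> B0 /andP[e0 e1].
have [C C0 CP] := sqnorm_mulmx_le (invsqrtm T).
have [K K0 KP] := ball_prob_to1 n (mulr_ge0 C0 B0) e0.
have [L L0 LP] := sqnorm_pt_mean_le q B0 K0.
have [M M0 MP] := ball_prob_to1 n L0 e0.
exists M => // tau D DB; rewrite -lee_fin (prob_PT_fin pS0 pS1 q tau D M).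
have e1' : 0 <= 1 - eps by lra.
apply: (@le_trans _ _ ((1 - eps)%:E * ball_prob K (invsqrtm T *m D))%E).
  rewrite expr2 EFinM; apply: lee_wpmul2l; first by rewrite lee_fin.
  apply: KP.
  by rewrite (le_trans (CP _))// ler_wpM2l.
apply: lebint_restr_ge => //.
- by apply: measurable_ball_prob; exact: measurable_pt_mean.
- by move=> u; exact: ball_prob_ge0.
- by move=> u uK; apply: MP; exact: LP.
Qed.

End pretest_bounds.

(** * The critical value *)

(** By the modulus, a value above [y] at the infimum would persist slightly to its left, and a value
    below [y] slightly to its right. Strict growth gives uniqueness. *)
Lemma level_inf (R : realType) (G : R -> R) (y : R) : 0 < y ->
  (forall M, M < 0 -> G M = 0) ->
  (forall M1 M2, 0 <= M1 -> M1 < M2 -> G M1 < G M2) ->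
  (forall M1 M2, M1 <= M2 -> G M2 <= G M1 + 2 * Num.sqrt (M2 - M1)) ->
  (exists2 M, 0 <= M & y <= G M) ->
  let m := inf [set M | 0 <= M /\ y <= G M] in
  G m = y /\ (forall M, 0 <= M -> G M = y -> M = m).
Proof.
move=> y0 Gneg Ginc Gmod [M0 M00 yM0] m.
set E := [set M | 0 <= M /\ y <= G M] in m *.
have E0 : E !=set0 by exists M0.
have lbE : lbound E 0 by move=> M [].
have hE : has_inf E by split=> //; exists 0.
have m0 : 0 <= m by exact: lb_le_inf.
have mE M : E M -> m <= M by move=> EM; apply: ge_inf => //; exists 0.
have sqrt_lt (e M1 M2 : R) : 0 < e -> M1 <= M2 -> M2 < M1 + e ^+ 2 -> Num.sqrt (M2 - M1) <= e.
  move=> e0 M12 M21; rewrite -(ger0_norm (ltW e0)) -sqrtr_sqr ler_wsqrtr//; lra.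
have Gm : G m = y.
  apply/eqP; rewrite eq_le; apply/andP; split; rewrite leNgt; apply/negP => h.
    (* Over a distance below [e ^+ 2] the modulus allows an increase of at most [2 * e], half the
       gap. *)
    pose e := (G m - y) / 4; have e0 : 0 < e by rewrite /e; lra.
    have m' : m - e ^+ 2 / 2 < m by rewrite ltrBlDr ltrDl divr_gt0// exprn_gt0.
    have Gm' : G (m - e ^+ 2 / 2) < y.
      (* For [m] near 0 the comparison point is negative and falls outside the set; there [G] is 0,
         still below [y]. *)
      have [n0|p0] := ltP (m - e ^+ 2 / 2) 0; first by rewrite Gneg.
      by rewrite ltNge; apply/negP => yG; have := mE _ (conj p0 yG); lra.
    have := Gmod _ _ (ltW m').
    have mlt : m < m - e ^+ 2 / 2 + e ^+ 2 by have := exprn_gt0 2 e0; lra.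
    by have := sqrt_lt e _ _ e0 (ltW m') mlt; rewrite /e; lra.
  pose e := (y - G m) / 4; have e0 : 0 < e by rewrite /e; lra.
  have e20 := exprn_gt0 2 e0.
  have [M EM Mm] := inf_adherent e20 hE; rewrite -/m in Mm.
  have := Gmod _ _ (mE _ EM); have := sqrt_lt e _ _ e0 (mE _ EM) Mm.
  by case: EM => _ yM; rewrite /e; lra.
split=> // M M1 GM; have [lt|lt|//] := ltgtP M m.
  by have := Ginc _ _ M1 lt; rewrite GM Gm ltxx.
by have := Ginc _ _ m0 lt; rewrite GM Gm ltxx.
Qed.

(** * The infimum over admissible biases *)

Section inf_prob.
Context {R : realType} (n : nat).
Variables (S0 S1 S : 'M[R]_n.+1) (b : 'cV[R]_n.+1) (q : R) (tau : 'cV[R]_n.+1).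
Hypotheses (pS0 : posdef S0) (pS1 : posdef S1) (pS : posdef S).
Hypothesis b0 : forall j, 0 <= b j ord0.
Local Notation G := (inf_prob_PT S0 S1 S b q tau).
Local Notation P D M := (prob_PT S0 S1 q tau D M).

Lemma inf_prob_PT_le D M : bias_ok S b D -> G M <= P D M.
Proof.
move=> bD; apply: ge_inf; last by exists D.
by exists 0 => _ [D' _ <-]; exact: prob_PT_ge0.
Qed.

Lemma inf_prob_PT_ge x M : (forall D, bias_ok S b D -> x <= P D M) -> x <= G M.
Proof.
move=> xP; apply: lb_le_inf => [|_ [D bD <-]]; last exact: xP.
(* The zero bias is admissible since [b] is nonnegative, so the infimum is over a nonempty set. *)
exists (P 0 M), 0 => //= j; rewrite mulmx0 mxE normr0; exact: b0.
Qed.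

(** A bias is S^(1/2) applied to its rescaled version, whose entries are bounded by those of [b]. *)
Lemma bias_ok_bounded : exists2 B : R, 0 <= B & forall D, bias_ok S b D -> sqnorm D <= B.
Proof.
have [C C0 CP] := sqnorm_mulmx_le (sqrtm S).
exists (C * sqnorm b); first by rewrite mulr_ge0// sqnorm_ge0.
move=> D bD; rewrite -(mulKVmx (sqrtm_unit pS) D) (le_trans (CP _))// ler_wpM2l//.
by apply: ler_sum => j _; rewrite -real_normK ?num_real// lerXn2r ?nnegrE// bD.
Qed.

(** The modulus, the gap and the limit are uniform over the admissible biases, so each passes to the
    infimum and [level_inf] applies. *)
Lemma inf_prob_PT_level zeta : 0 < zeta < 1 ->
  G (M_PT S0 S1 S b q zeta tau) = 1 - zeta /\
  (forall M, 0 <= M -> G M = 1 - zeta -> M = M_PT S0 S1 S b q zeta tau).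
Proof.
move=> /andP[z0 z1]; have [B B0 BP] := bias_ok_bounded.
apply: level_inf.
- lra.
- move=> M M0; apply/eqP; rewrite eq_le; apply/andP; split.
    rewrite -(prob_PT_lt0 pS0 pS1 q tau 0 M0); apply: inf_prob_PT_le => j.
    by rewrite mulmx0 mxE normr0.
  by apply: inf_prob_PT_ge => D _; exact: prob_PT_ge0.
- move=> M1 M2 M10 M12; have [c c0 cP] := prob_PT_strict pS0 pS1 q B0 M10 M12.
  apply: (@lt_le_trans _ _ (G M1 + c)); first by rewrite ltrDl.
  apply: inf_prob_PT_ge => D bD; apply: le_trans (cP tau D (BP _ bD)).
  by rewrite lerD2r; exact: inf_prob_PT_le.
- move=> M1 M2 M12; rewrite -lerBlDr; apply: inf_prob_PT_ge => D bD.
  rewrite lerBlDr; apply: le_trans (prob_PT_le pS0 pS1 q tau D M12).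
  exact: inf_prob_PT_le.
(* The choice [zeta / 2] works because (1 - zeta / 2)^2 >= 1 - zeta. *)
- have e01 : 0 < zeta / 2 <= 1 by apply/andP; split; lra.
  have [M M0 MP] := prob_PT_to1 pS0 pS1 q B0 e01.
  exists M => //; apply: inf_prob_PT_ge => D bD.
  by apply: le_trans (MP tau D (BP _ bD)); have := sqr_ge0 (zeta / 2); lra.
Qed.

End inf_prob.

Theorem theorem5 (R : realType) (d : nat) (S0 S1 S : 'M[R]_d) (b : 'cV[R]_d)
    (zeta q : R) :
  (1 <= d)%N -> posdef S0 -> posdef S1 -> posdef S ->
  (forall j : 'I_d, 0 <= b j ord0) -> 0 < zeta < 1 -> 0 <= q ->
  (forall (tau t : 'cV[R]_d) (M : R), 0 <= M ->
     (prob_PT S0 S1 q tau (sqrtm S *m t) M)%:E =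
     ((ncchi2_cdf d M
         (sqnorm (invsqrtm (invmx S0 + invmx S1) *m invmx S1 *m sqrtm S *m t)) *
       ncchi2_cdf d q (sqnorm (invsqrtm (S0 + S1) *m sqrtm S *m t)))%R%:E +
      @lebint R d (fun u : 'cV[R]_d =>
        if (q < sqnorm u)%R then
          (ncchi2_cdf d M
             (sqnorm (invsqrtm (invmx S0 + invmx S1) *m invmx S1 *m
                        (sqrtm S *m t - sqrtm (S0 + S1) *m u))) *
           gauss_pdf (invsqrtm (S0 + S1) *m sqrtm S *m t) 1%:M u)%R%:E
        else 0%E))%E) /\
  (forall tau : 'cV[R]_d,
     inf_prob_PT S0 S1 S b q tau (M_PT S0 S1 S b q zeta tau) = 1 - zeta /\
     (forall M : R, 0 <= M -> inf_prob_PT S0 S1 S b q tau M = 1 - zeta ->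
        M = M_PT S0 S1 S b q zeta tau)).
Proof.
case: d S0 S1 S b => [//|n] S0 S1 S b _ pS0 pS1 pS b0 zeta01 _; split.
  move=> tau t M _.
  rewrite -!(mulmxA _ (sqrtm S) t).
  exact: (prob_PT_split pS0 pS1 q tau (sqrtm S *m t) M).
move=> tau; exact: inf_prob_PT_level.
Qed.
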